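(* Let $0<p<3/4$, let $\{\widetilde S_n,\ n\ge 1\}$ be the elephant random walk with full memory, parameter $p$ and first step $\widetilde X_1\equiv 1$, let $R$ be a real random variable with distribution function $F_R$, independent of $\{\widetilde X_n,\ n\ge 1\}$, and put $S_n=R\,\widetilde S_n$. Then, as $n\to\infty$, $S_n/\sqrt n$ converges in distribution to the law with distribution function $$x\mapsto \int_{\mathbb R\setminus\{0\}}\mathcal N_{0,\frac1{3-4p}}(x/|t|)\,dF_R(t)+P(R=0)\cdot\delta_{[0,\infty)}(x).$$ Moreover, if $E(R^2)<\infty$, then $E(S_n/\sqrt n)\to 0$ and $E\big((S_n/\sqrt n)^2\big)\to E(R^2)/(3-4p)$ as $n\to\infty$.
   Context: Elephant random walk with full memory, parameter $p$ and $\widetilde X_1\equiv 1$: for each $n\ge 1$, given $\widetilde X_1,\dots,\widetilde X_n$, choose an index $K$ uniformly on $\{1,\dots,n\}$ and set $\widetilde X_{n+1}=\widetilde X_K$ with probability $p$ and $\widetilde X_{n+1}=-\widetilde X_K$ with probability $1-p$ (the index and the sign being chosen independently of each other and of the past). The walk is $\widetilde S_n=\sum_{k=1}^n\widetilde X_k$. $\mathcal N_{0,\sigma^2}$ denotes the distribution function of the normal law with mean $0$ and variance $\sigma^2$, and $\delta_{[0,\infty)}(x)=1$ if $x\ge 0$, $=0$ if $x<0$. *)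

(* Defs.v *)
From HB Require Import structures.
From mathcomp Require Import all_boot all_order all_algebra.
From mathcomp Require Import all_classical all_reals all_analysis.
From mathcomp Require Import measurable_realfun.

Set Implicit Arguments.
Unset Strict Implicit.
Unset Printing Implicit Defensive.

Import Order.TTheory GRing.Theory Num.Theory.
Import numFieldNormedType.Exports.

Local Open Scope classical_set_scope.
Local Open Scope ring_scope.

Section elephant.
Context (d : measure_display) (T : measurableType d) (R : realType)
  (P : probability T R).
Implicit Types (X : nat -> {mfun T >-> R}) (Y : {mfun T >-> R}).

Definition sigma_rv d' (U : measurableType d') (Z : {mfun T >-> U}) :
  set (set T) := preimage_set_system setT Z measurable.

Definition sigma_process (I : set nat) X : set (set T) :=
  <<s \bigcup_(k in I) sigma_rv (X k) >>.

Definition independent2 (F G : set (set T)) : Prop :=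
  forall A B, F A -> G B -> P (A `&` B) = (P A * P B)%E.

(* The triple product rule suffices for mutual independence because the three
   systems below are sigma-algebras: taking one of the events to be the whole
   space gives the rule for pairs. *)
Definition independent3 (F G H : set (set T)) : Prop :=
  forall A B C, F A -> G B -> H C ->
    P (A `&` B `&` C) = (P A * P B * P C)%E.

(* Steps are numbered from 1; the value X 0 plays no role.  B is the event
   that the remembered step is repeated rather than reversed. *)
Record elephant_random_walk (p : R) (X : nat -> {RV P >-> R}) : Prop := {
  erw_first : forall w, X 1%N w = 1 ;
  erw_step : forall n, (1 <= n)%N ->
    exists (K : {RV P >-> nat}) (B : {RV P >-> bool}),
      [/\ forall w, (1 <= K w <= n)%N,
          forall k, (1 <= k <= n)%N ->
            P [set w | K w = k] = (n%:R^-1)%:E,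
          P [set w | B w = true] = p%:E,
          independent3 (sigma_process [set k | (1 <= k <= n)%N] X)
            (sigma_rv K) (sigma_rv B) &
          forall w, X n.+1 w = if B w then X (K w) w else - X (K w) w] }.

Definition walk X (n : nat) (w : T) : R := \sum_(1 <= k < n.+1) X k w.

Definition scaled_walk Y X (n : nat) (w : T) : R :=
  Y w * walk X n w / Num.sqrt n%:R.

Lemma measurable_scaled_walk Y X n : measurable_fun setT (scaled_walk Y X n).
Proof.
apply: measurable_funM; last exact: measurable_cst.
by apply: measurable_funM => //; exact: measurable_sum.
Qed.

HB.instance Definition _ Y X n :=
  isMeasurableFun.Build _ _ _ _ (scaled_walk Y X n)
    (measurable_scaled_walk Y X n).

Definition cvg_in_distribution (Z : nat -> {RV P >-> R})
    (mu : probability (measurableTypeR R) R) : Prop :=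
  let F := fun x : R => mu `]-oo, x]%classic in
  forall x : R, {for x, continuous F} -> cdf (P := P) (Z n) x @[n --> \oo] --> F x.

End elephant.

Arguments elephant_random_walk {d T R} P p X.
Arguments cvg_in_distribution {d T R} P Z mu.

(* The second parameter of normal_prob is the standard deviation. *)
Definition normal_cdf (R : realType) (sigma2 x : R) : \bar R :=
  normal_prob 0 (Num.sqrt sigma2) `]-oo, x]%classic.

(* Integration against the distribution of Y is the Stieltjes integral
   against its distribution function. *)
Definition limit_cdf d (T : measurableType d) (R : realType)
    (P : probability T R) (p : R) (Y : {RV P >-> R}) (x : R) : \bar R :=
  (\int[distribution P Y]_(t in [set t : R | t != 0%R])
      normal_cdf (3 - 4 * p)^-1%R (x / `|t|)%R
   + P [set w | Y w = 0%R] * (\1_(`[0%R, +oo[%classic : set R) x)%:E)%E.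
Arguments limit_cdf {d T R} P p Y x.

(* Main.v *)
From HB Require Import structures.
Require Import Defs.
From mathcomp Require Import all_boot all_order all_algebra.
From mathcomp Require Import all_classical all_reals all_analysis.
From mathcomp Require Import measurable_realfun ring lra.
Import Order.TTheory GRing.Theory Num.Theory.
Import numFieldNormedType.Exports.
Local Open Scope classical_set_scope.
Local Open Scope ring_scope.

(** Given the past, the walk moves up with probability [(1 + a S_n / n) / 2],
    where [a = 2 p - 1]; hence [E h(S_{n+1}) = E (walk_step a n h)(S_n)], and the
    law of the walk is carried by the functional [walk_mean], on which the
    analysis is purely real.  The central limit theorem is a Lindeberg
    replacement with the test functions [s |-> Phi ((z - g s) / sqrt v)], [Phi]
    the standard normal distribution function: by the heat equation, undoing the
    step from [n] to [n + 1] turns [(g, v)] into [(g (1 + a / n), v + g^2)] up to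
    a small error.  With [g = 1 / sqrt n] the errors add up to [o(1)] because
    [a < 1 / 2], [g] ends at [0] and [v] gains [1 / (1 - 2 a) = 1 / (3 - 4 p)];
    letting the initial [v] tend to [0] gives convergence of the distribution
    functions.  The independent factor [Y] is integrated out:
    [E f(Y, S_n)] is [walk_mean] applied to [s |-> E f(Y, s)].  Dominated
    convergence then gives the limit, which is the law of [Y] times an
    independent normal variable; the moments follow from the recursions
    satisfied by those of the walk. *)

(** * Linear recursions with coefficients [1 + a / n] *)

Lemma expR_harmonic_cvg0 {R : realType} (c : R) : 0 < c ->
  expR (- (c * series harmonic n)) @[n --> \oo] --> (0 : R).
Proof.
move=> c0.
apply: (@cvg_comp _ _ _ (fun n => c * series harmonic n)
  (fun x => expR (- x)) _ +oo); last exact: cvgr_expR.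
apply/cvgryPge => A.
have := @nondecreasing_dvgn_lt R (series harmonic) _ (@dvg_harmonic R).
move=> H.
have /cvgryPge /(_ (A / c)) : series harmonic @ \oo --> (+oo : set_system R).
  apply: H; apply/nondecreasing_seqP => n.
  by rewrite seriesSr lerDl harmonic_ge0.
by apply: filterS => n; rewrite ler_pdivrMr // mulrC.
Qed.

(* Comparing with [exp (- c H_n)], where [H_n] is the harmonic sum. *)
Lemma contraction_cvg0 {R : realType} (c : R) (y e : nat -> R) :
  0 < c -> e @ \oo --> 0 ->
  (\forall n \near \oo,
    `|y n.+1| <= (1 - c / n.+2%:R) * `|y n| + e n / n.+2%:R) ->
  y @ \oo --> 0.
Proof.
move=> c0 e0 ye; apply/cvgrPdist_le => eps eps0.
have /cvgrPdist_le /(_ (c * (eps / 2))) e0' := e0.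
have ce : 0 < c * (eps / 2) by rewrite mulr_gt0// divr_gt0.
have [N _ HN] : \forall n \near \oo, [/\ c <= n.+2%:R, e n <= c * (eps / 2) &
    `|y n.+1| <= (1 - c / n.+2%:R) * `|y n| + e n / n.+2%:R].
  near=> n; split.
  - rewrite (@le_trans _ _ n%:R)// ?ler_nat; last by rewrite -addn2 leq_addr.
    near: n; exact: nbhs_infty_ger.
  - have : `|0 - e n| <= c * (eps / 2) by near: n; exact: e0'.
    by rewrite sub0r normrN; apply: le_trans; exact: ler_norm.
  - by near: n.
(* The excess of [|y n|] over [eps / 2]. Once [e n <= c * (eps / 2)], the forcing term is absorbed
   by the contraction of [eps / 2], so the excess obeys the inequality without forcing. *)
pose z n := Num.max (`|y n| - eps / 2) 0.
have z0 n : 0 <= z n by rewrite /z le_max lexx orbT.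
have zS n : (N <= n)%N -> z n.+1 <= expR (- (c * harmonic n.+1)) * z n.
  move=> Nn; have [cn en yn] := HN n Nn.
  have n2 : 0 < (n.+2%:R : R) by rewrite ltr0n.
  have q0 : 0 <= 1 - c / n.+2%:R by rewrite subr_ge0 ler_pdivrMr// mul1r.
  rewrite (@le_trans _ _ ((1 - c / n.+2%:R) * z n))//; last first.
    rewrite ler_wpM2r// (le_trans _ (expR_ge1Dx _))//.
  rewrite /z ge_max; apply/andP; split; last by rewrite mulr_ge0 ?z0.
  rewrite (@le_trans _ _ ((1 - c / n.+2%:R) * (`|y n| - eps / 2)))//.
    have : e n / n.+2%:R <= c * (eps / 2) / n.+2%:R by rewrite ler_pM2r ?invr_gt0.
    have -> : (1 - c / n.+2%:R) * (`|y n| - eps / 2) =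
        (1 - c / n.+2%:R) * `|y n| - eps / 2 + c * (eps / 2) / n.+2%:R by ring.
    move: yn; set A := (_ * `|y n|); set B := c * _ / _; set E := e n / _.
    lra.
  by rewrite ler_wpM2l// le_max lexx.
(* The successive factors [expR (- (c * harmonic k))] multiply to the exponential of a difference of
   harmonic sums, which tends to [0]. *)
have zN n : z (N + n)%N <= z N * expR (c * series harmonic N.+1) *
    expR (- (c * series harmonic (N + n).+1)).
  elim: n => [|n IH].
    by rewrite addn0 -mulrA -expRD subrr expR0 mulr1.
  rewrite addnS (le_trans (zS _ (leq_addr _ _)))//.
  rewrite (le_trans (ler_wpM2l (expR_ge0 _) IH))//.
  rewrite (seriesSr _ (N + n).+1) mulrDr opprD expRD.
  by rewrite [leRHS]mulrA [leLHS]mulrC.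
have := @expR_harmonic_cvg0 R c c0.
move=> /(cvgM (cvg_cst (z N * expR (c * series harmonic N.+1)))).
rewrite mulr0 => /cvgrPdist_le /(_ (eps / 2)).
rewrite divr_gt0// => /(_ isT) [M _ HM].
near=> n.
have nN : (N <= n)%N by near: n; exact: nbhs_infty_ge.
have nM : (M <= n.+1)%N.
  by rewrite (@leq_trans n)//; near: n; exact: nbhs_infty_ge.
have /= := HM _ nM; rewrite !sub0r !normrN => H.
have := zN (n - N)%N; rewrite subnKC// => H2.
have := le_trans H2 (le_trans (ler_norm _) H).
rewrite /z ge_max => /andP[+ _]; lra.
Unshelve. all: by end_near. Qed.

Lemma invSn_cvg0 {R : realType} : (n.+1%:R^-1 : R) @[n --> \oo] --> (0 : R).
Proof. exact: cvg_harmonic. Qed.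

(** With [m = n + 1], division by the index turns the factor into [m (1 + a / m)^2 / (m + 1) = 1 -
    (1 - 2 a - a^2 / m) / (m + 1)], a contraction for large [m] because [a < 1 / 2]. *)
Lemma growth_cvg0 {R : realType} (a : R) (z e : nat -> R) :
  a < 1 / 2 -> e @ \oo --> 0 ->
  (\forall n \near \oo,
    `|z n.+1| <= (1 + a / n.+1%:R) ^+ 2 * `|z n| + e n) ->
  z n / n.+1%:R @[n --> \oo] --> 0.
Proof.
move=> a2 e0 H.
(* Half of the rate [1 - 2 a]; the other half absorbs [a^2 / (n + 1)]. *)
pose c := (1 - 2 * a) / 2.
have c0 : 0 < c by rewrite /c; lra.
apply: (@contraction_cvg0 R c _ e) => //.
have H2 : \forall n \near \oo, a ^+ 2 / n.+1%:R <= c.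
  have /(cvgM (cvg_cst (a ^+ 2))) := @invSn_cvg0 R.
  rewrite mulr0 => /cvgrPdist_le /(_ c c0).
  apply: filterS => n; rewrite sub0r normrN; apply: le_trans.
  exact: ler_norm.
near=> n.
have h1 : `|z n.+1| <= (1 + a / n.+1%:R) ^+ 2 * `|z n| + e n by near: n.
have h2 : a ^+ 2 / n.+1%:R <= c by near: n.
have n1 : (n.+1%:R : R) != 0 by [].
have n1p : 0 < (n.+1%:R : R) by rewrite ltr0n.
have n2 : (n.+2%:R : R) = n.+1%:R + 1 by rewrite -natr1.
rewrite !normrM !normfV !normr_nat ler_pdivrMr ?ltr0n//.
rewrite mulrDl divfK// (le_trans h1)// lerD2r.
rewrite -subr_ge0.
have -> : (1 - c / n.+2%:R) * (`|z n| / n.+1%:R) * n.+2%:R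
     - (1 + a / n.+1%:R) ^+ 2 * `|z n|
   = `|z n| / n.+1%:R * (1 - 2 * a - c - a ^+ 2 / n.+1%:R).
  by rewrite n2; field; rewrite nat1r natr1 !pnatr_eq0.
rewrite mulr_ge0 ?divr_ge0//; move: (a ^+ 2 / _) h2 => t; rewrite /c; lra.
Unshelve. all: by end_near. Qed.

(** * The centered normal distribution function *)

Lemma normal_prob_itv_fin {R : realType} (m s x : R) :
  normal_prob m s `]-oo, x]%classic \is a fin_num.
Proof. exact: fin_num_measure. Qed.

(** Real-valued, so that it can be differentiated; [s] is the standard deviation. *)
Definition ncdf {R : realType} (s x : R) : R :=
  fine (normal_prob 0 s `]-oo, x]%classic).

Lemma ncdfE {R : realType} (s x : R) :
  normal_prob 0 s `]-oo, x]%classic = (ncdf s x)%:E.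
Proof. by rewrite /ncdf fineK ?normal_prob_itv_fin. Qed.

(** The identity seen as a random variable under the normal law: its [cdf] is [ncdf], whose limits
    at infinity then come from those of a general [cdf]. *)
Definition idreal {R : realType} : measurableTypeR R -> R := idfun.

HB.instance Definition _ (R : realType) :=
  @isMeasurableFun.Build _ _ _ _ (@idreal R) (@measurable_id _ _ setT).

Lemma cdf_normal {R : realType} (s : R) :
  (fun x => (ncdf s x)%:E) = cdf (P := normal_prob 0 s)
    (@idreal R).
Proof. by apply/funext => x; rewrite -ncdfE. Qed.

Lemma ncdf_ge0 {R : realType} (s x : R) : 0 <= ncdf s x.
Proof. by rewrite -lee_fin -ncdfE. Qed.

Lemma ncdf_le1 {R : realType} (s x : R) : ncdf s x <= 1.
Proof. by rewrite -lee_fin -ncdfE probability_le1. Qed.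

Lemma ncdf_le {R : realType} (s x y : R) : x <= y -> ncdf s x <= ncdf s y.
Proof.
move=> xy; rewrite -lee_fin -!ncdfE; apply: le_measure; rewrite ?inE//.
exact: subset_itvl.
Qed.

Lemma cvg_ncdfy {R : realType} (s : R) : ncdf s x @[x --> +oo] --> (1 : R).
Proof.
have := cvg_cdfy1 (@idreal R : {RV normal_prob 0 s >-> R}).
by rewrite -cdf_normal => /fine_cvg.
Qed.

Lemma cvg_ncdfNy {R : realType} (s : R) : ncdf s x @[x --> -oo] --> (0 : R).
Proof.
have := cvg_cdfNy0 (@idreal R : {RV normal_prob 0 s >-> R}).
by rewrite -cdf_normal => /fine_cvg.
Qed.

Lemma is_derive_ncdf {R : realType} (s x : R) : s != 0 ->
  is_derive x 1 (ncdf s) (normal_pdf 0 s x).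
Proof.
move=> s0.
have xx : x < x + 1 by rewrite ltrDl.
have int : lebesgue_measure.-integrable [set` `]-oo, (x + 1)]]
    (EFin \o normal_pdf 0 s).
  by apply: integrableS (integrable_normal_pdf 0 s).
have [D E] := continuous_FTC1 xx int (ltNyr _)
  (fun A => @continuous_normal_pdf R 0 s s0 x A).
by split; [exact: D|rewrite -derive1E; exact: E].
Qed.

Lemma is_derive_continuous {R : realType} (f df : R -> R) :
  (forall x : R, is_derive x 1 f (df x)) -> continuous f.
Proof.
move=> H x; apply: differentiable_continuous; apply/derivable1_diffP.
by case: (H x).
Qed.

Lemma continuous_ncdf {R : realType} (s : R) : s != 0 -> continuous (ncdf s).
Proof. by move=> s0; apply: is_derive_continuous => x; exact: is_derive_ncdf. Qed.

Lemma is_derive_ncdf_scale {R : realType} (c s x : R) : s != 0 ->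
  is_derive x 1 (fun y => ncdf s (c * y)) (normal_pdf 0 s (c * x) * c).
Proof.
move=> s0; apply: (@is_derive1_comp _ (ncdf s) (fun y => c * y)).
  exact: is_derive_ncdf.
have := @is_deriveZ R _ _ id c x 1 1 (is_derive_id _ _).
by rewrite /GRing.scale /= mulr1.
Qed.

Lemma normal_pdf_scale {R : realType} (s y : R) : 0 < s ->
  normal_pdf 0 1 (s^-1 * y) * s^-1 = normal_pdf 0 s y.
Proof.
move=> s0.
rewrite !normal_pdfE ?gt_eqF// /normal_peak /normal_fun !subr0 expr1n mul1r.
rewrite -mulrnAr sqrtrM ?sqr_ge0// sqrtr_sqr gtr0_norm// invfM.
have -> : - (s^-1 * y) ^+ 2 / 2 = - y ^+ 2 / (s ^+ 2 *+ 2).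
  by rewrite -[in RHS]mulr_natr; field; rewrite gt_eqF.
by rewrite [LHS]mulrC mulrA.
Qed.

(** Determines the constant of integration of a function with zero derivative from its limit at
    infinity. *)
Lemma cvg_cst_unique {R : realType} {F : set_system R} {FF : ProperFilter F}
  (f : R -> R) (x l : R) :
  (forall y, f y = f x) -> f y @[y --> F] --> l -> f x = l.
Proof.
move=> fE fl; apply: (cvg_unique (@Rhausdorff R) _ fl).
by rewrite (_ : f = cst (f x)); [exact: cvg_cst|apply/funext].
Qed.

(** Both sides have the same derivative and vanish at [-oo]. *)
Lemma ncdf_scale {R : realType} (s x : R) : 0 < s -> ncdf s x = ncdf 1 (s^-1 * x).
Proof.
move=> s0; have s_neq0 : s != 0 by rewrite gt_eqF.
pose K x := ncdf s x - ncdf 1 (s^-1 * x).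
have dK (y : R) : is_derive y 1 K 0.
  rewrite (_ : 0 = normal_pdf 0 s y - normal_pdf 0 1 (s^-1 * y) * s^-1); last first.
    by rewrite normal_pdf_scale// subrr.
  apply: is_deriveB; first exact: is_derive_ncdf.
  exact: is_derive_ncdf_scale.
have K0 : K y @[y --> -oo] --> (0 : R).
  rewrite -(subrr 0); apply: cvgB; first exact: cvg_ncdfNy.
  apply: (@cvg_comp _ _ _ (fun y => s^-1 * y) (ncdf 1) _ -oo);
    last exact: cvg_ncdfNy.
  apply/cvgrNyPle => A; exists (s * A); split; first by rewrite num_real.
  by move=> y yA; rewrite ler_pdivrMl// ltW.
have E : K x = 0.
  by apply: (cvg_cst_unique _ _ _ _ K0) => y; exact: is_derive_0_is_cst.
exact: subr0_eq E.
Qed.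

(** The density is even, so [ncdf s x + ncdf s (- x)] has zero derivative; its limit at [+oo] is
    [1]. *)
Lemma ncdfN {R : realType} (s x : R) : s != 0 -> ncdf s (- x) = 1 - ncdf s x.
Proof.
move=> s0.
pose K x := ncdf s x + ncdf s (-1 * x).
have dK (y : R) : is_derive y 1 K 0.
  rewrite (_ : 0 = normal_pdf 0 s y + normal_pdf 0 s (-1 * y) * -1); last first.
    by rewrite !normal_pdfE// /normal_fun !subr0 mulN1r sqrrN mulrN1 subrr.
  apply: is_deriveD; first exact: is_derive_ncdf.
  exact: is_derive_ncdf_scale.
have K0 : K y @[y --> +oo] --> (1 : R).
  rewrite -[X in _ --> X](addr0 1); apply: cvgD; first exact: cvg_ncdfy.
  apply: (@cvg_comp _ _ _ (fun y => -1 * y) (ncdf s) _ -oo);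
    last exact: cvg_ncdfNy.
  apply/cvgrNyPle => A; exists (- A); split; first by rewrite num_real.
  by move=> y yA; rewrite mulN1r; lra.
have : K x = 1.
  by apply: (cvg_cst_unique _ _ _ _ K0) => y; exact: is_derive_0_is_cst.
by rewrite /K mulN1r => E; lra.
Qed.

(** * Taylor estimates for the normal distribution function *)

Lemma mvt_between {R : realType} (f df : R -> R) (a h : R) :
  (forall x : R, is_derive x 1 f (df x)) ->
  exists2 t, 0 <= t <= 1 & f (a + h) - f a = df (a + t * h) * h.
Proof.
move=> fdf.
(* Parametrising the segment by [[0, 1]] treats both signs of [h] at once. *)
pose g t := f (a + t * h).
have gdg (t : R) : is_derive t 1 g (df (a + t * h) * h).
  apply: (@is_derive1_comp _ f (fun t => a + t * h)).
  rewrite -[X in is_derive _ _ _ X]add0r; apply: is_deriveD.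
  have := @is_deriveZ R _ _ id h t 1 1 (is_derive_id _ _).
  rewrite /GRing.scale /= mulr1; congr is_derive.
  by apply/funext => y /=; rewrite mulrC.
have [t] := @MVT_segment R g _ 0 1 ler01 (fun x _ => gdg x)
  (continuous_subspaceT (is_derive_continuous _ _ gdg)).
rewrite in_itv /= => t01; rewrite /g mul1r mul0r addr0 subr0 mulr1 => E.
by exists t.
Qed.

(** Two applications of the mean value theorem. The second derivative is bounded only on the
    segment, so that [C] may depend on its endpoints. *)
Lemma taylor1_bound {R : realType} (f df ddf : R -> R) (a h C : R) :
  (forall x : R, is_derive x 1 f (df x)) ->
  (forall x : R, is_derive x 1 df (ddf x)) ->
  (forall t, 0 <= t <= 1 -> `|ddf (a + t * h)| <= C) ->
  `|f (a + h) - f a - df a * h| <= C * h ^+ 2.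
Proof.
move=> fdf dfddf ddfC.
have [t /andP[t0 t1] ->] := mvt_between f df a h fdf.
have [u /andP[u0 u1] E] := mvt_between df ddf a (t * h) dfddf.
have := ddfC (u * t); rewrite mulr_ge0//= mulr_ile1// => /(_ isT).
rewrite -mulrBl E -(mulrA u); set d := ddf _ => dC.
rewrite (_ : d * (t * h) * h = d * (t * h ^+ 2)); last by ring.
rewrite normrM (ger0_norm (mulr_ge0 t0 (sqr_ge0 h))).
by apply: ler_pM => //; [rewrite mulr_ge0 ?sqr_ge0|rewrite ler_piMl ?sqr_ge0].
Qed.

Lemma taylor2_bound {R : realType} (f df ddf dddf : R -> R) (a h C : R) :
  (forall x : R, is_derive x 1 f (df x)) ->
  (forall x : R, is_derive x 1 df (ddf x)) ->
  (forall x : R, is_derive x 1 ddf (dddf x)) ->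
  (forall x, `|dddf x| <= C) ->
  `|f (a + h) - f a - df a * h - ddf a * h ^+ 2 / 2| <= C * `|h| ^+ 3.
Proof.
move=> fdf dfddf ddfd dC.
(* Once the quadratic term is removed, the mean value theorem reduces the claim to the first-order
   estimate for [df]. *)
pose g x := f x - (ddf a / 2) * (x - a) ^+ 2.
have gdg (x : R) : is_derive x 1 g (df x - ddf a * (x - a)).
  apply: is_deriveB.
  rewrite (_ : ddf a * (x - a) = (ddf a / 2) *: (2 * (x - a))); last first.
    by rewrite /GRing.scale /=; field.
  apply: is_deriveZ.
  apply: is_derive_eq; rewrite /GRing.scale /=; ring.
have [t /andP[t0 t1] E] := mvt_between g _ a h gdg.
have -> : f (a + h) - f a - df a * h - ddf a * h ^+ 2 / 2 =
   (df (a + t * h) - df a - ddf a * (t * h)) * h.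
  rewrite mulrBl mulrBl (_ : df (a + t * h) * h =
      g (a + h) - g a + ddf a * (t * h) * h).
    by rewrite /g; field.
  by rewrite E; ring.
have H := taylor1_bound df ddf dddf a (t * h) C dfddf ddfd (fun _ _ => dC _).
have C0 : 0 <= C by rewrite (le_trans _ (dC 0)).
rewrite normrM exprSr [leRHS]mulrA.
apply: ler_wpM2r => //; apply: le_trans H _; apply: ler_wpM2l => //.
by rewrite real_normK ?num_real// exprMn ler_piMl ?sqr_ge0// exprn_ile1.
Qed.

Lemma normal_pdf_std {R : realType} :
  normal_pdf 0 1 = (fun y : R => normal_peak 1 * expR (- (y ^+ 2 / 2))).
Proof.
apply/funext => y.
by rewrite normal_pdfE ?oner_eq0// /normal_fun subr0 expr1n mulNr.
Qed.

Lemma is_derive_normal_pdf {R : realType} (x : R) :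
  is_derive x 1 (normal_pdf 0 1) (- (x * normal_pdf 0 1 x)).
Proof.
rewrite normal_pdf_std.
have H : is_derive x 1 (fun y : R => - (y ^+ 2 / 2)) (- x).
  by apply: is_derive_eq; rewrite /GRing.scale /=; field.
have H2 := @is_derive1_comp _ expR (fun y : R => - (y ^+ 2 / 2)) x _ _
  (is_derive_expR _) H.
have H3 := @is_deriveZ R _ _ _ (normal_peak 1) x 1 _ H2.
by apply: is_derive_eq; rewrite /GRing.scale /=; ring.
Qed.

Lemma is_derive_normal_pdf1 {R : realType} (x : R) :
  is_derive x 1 (fun y => - (y * normal_pdf 0 1 y))
   ((x ^+ 2 - 1) * normal_pdf 0 1 x).
Proof.
rewrite (_ : _ * _ =
  - (x *: (- (x * normal_pdf 0 1 x)) + normal_pdf 0 1 x *: 1)); last first.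
  by rewrite /GRing.scale /=; ring.
apply: is_deriveN.
by apply: (@is_deriveM _ _ id (normal_pdf 0 1)); exact: is_derive_normal_pdf.
Qed.

(** [exp (x^2 / 2)] is the square of [exp (x^2 / 4)], which is at least [1 + x^2 / 4]. Polynomials
    of degree at most four times the density are therefore bounded. *)
Lemma normal_pdf_decay {R : realType} (x : R) :
  normal_pdf 0 1 x * (1 + x ^+ 2 / 4) ^+ 2 <= normal_peak 1.
Proof.
rewrite normal_pdf_std -mulrA.
rewrite ler_piMr ?normal_peak_ge0//.
have -> : x ^+ 2 / 2 = x ^+ 2 / 4 + x ^+ 2 / 4 by field.
rewrite expRN expRD mulrC ler_pdivrMr ?mulr_gt0 ?expR_gt0// mul1r -expr2.
by rewrite lerXn2r ?nnegrE ?expR_ge0 ?expR_ge1Dx// addr_ge0// divr_ge0// sqr_ge0.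
Qed.

Lemma normal_pdf_mul_bound {R : realType} (x y : R) :
  `|y| <= 4 * (1 + x ^+ 2 / 4) ^+ 2 ->
  `|y * normal_pdf 0 1 x| <= 4 * normal_peak 1.
Proof.
move=> yx; rewrite normrM (ger0_norm (normal_pdf_ge0 _ _ _)).
have := normal_pdf_decay x.
have := ler_wpM2r (normal_pdf_ge0 0 1 x) yx; lra.
Qed.

Lemma normal_pdf1_bound {R : realType} (x : R) :
  `|x * normal_pdf 0 1 x| <= 4 * normal_peak 1.
Proof. apply: normal_pdf_mul_bound; rewrite ler_norml; nra. Qed.

Lemma normal_pdf2_bound {R : realType} (x : R) :
  `|(x ^+ 2 - 1) * normal_pdf 0 1 x| <= 4 * normal_peak 1.
Proof. apply: normal_pdf_mul_bound; rewrite ler_norml; nra. Qed.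

Lemma normal_pdf3_bound {R : realType} (x : R) :
  `|x ^+ 3 * normal_pdf 0 1 x| <= 4 * normal_peak 1.
Proof.
apply: normal_pdf_mul_bound; rewrite normrX.
rewrite -(real_normK (num_real x)); set y := `|x|.
(* Expanding [(y^2 / 2 - y)^2 >= 0] gives [y^3 <= y^4 / 4 + y^2]. *)
have h1 := sqr_ge0 (y ^+ 2 / 2 - y); have h2 := sqr_ge0 y.
by nra.
Qed.

(* Second-order heat equation, the time derivative being half the second space
   derivative. *)
Lemma ncdf_shrink {R : realType} (w t : R) : 0 <= t ->
  `|ncdf 1 (w / Num.sqrt (1 + t)) - ncdf 1 w + w * normal_pdf 0 1 w * t / 2|
    <= 4 * normal_peak 1 * t ^+ 2.
Proof.
move=> t0; set K := 4 * normal_peak 1; set r := Num.sqrt (1 + t).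
have r2 : r ^+ 2 = 1 + t by rewrite sqr_sqrtr// addr_ge0.
have r1 : 1 <= r by rewrite -[leLHS]sqrtr1 ler_wsqrtr// lerDl.
have K0 : 0 <= K by rewrite mulr_ge0// normal_peak_ge0.
(* The Taylor constant below has [w ^+ 2] in its denominator. *)
have [->|w0] := eqVneq w 0.
  by rewrite !mul0r subrr addr0 normr0 mulr_ge0// sqr_ge0.
have rt : (r - 1) ^+ 2 <= t ^+ 2 / 4.
  have -> : t = (r - 1) * (r + 1) by rewrite -subr_sqr r2; ring.
  rewrite exprMn -mulrA ler_peMr ?sqr_ge0//.
  by rewrite ler_pdivlMr// mul1r; nra.
have rn0 : r != 0 by rewrite gt_eqF// (lt_le_trans ltr01).
(* Points [x] between [w / r] and [w] satisfy [|x| >= |w| / r], so the bound on [x^3] times the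
   density gives the constant [K r^2 / w^2]; multiplied by the squared increment
   [w^2 (r - 1)^2 / r^2] it leaves [K (r - 1)^2], uniformly in [w]. *)
have T := taylor1_bound _ _ _ w (w / r - w) (K * r ^+ 2 / w ^+ 2)
  (fun x => is_derive_ncdf 1 x (oner_neq0 _)) is_derive_normal_pdf.
have {}T : `|ncdf 1 (w / r) - ncdf 1 w - normal_pdf 0 1 w * (w / r - w)|
    <= K * (r - 1) ^+ 2.
  rewrite (_ : w + (w / r - w) = w / r) in T; last by ring.
  apply: le_trans (T _) _; last first.
    by rewrite le_eqVlt; apply/orP; left; apply/eqP; field; rewrite rn0 w0.
  move=> s /andP[s0 s1]; set x := w + _.
  rewrite ler_pdivlMr ?exprn_even_gt0// normrN.
  have wx : w ^+ 2 <= r ^+ 2 * x ^+ 2.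
    rewrite -exprMn.
    have -> : r * x = w * (r * (1 - s) + s) by rewrite /x; field.
    rewrite exprMn ler_peMr ?sqr_ge0// exprn_ege1//; nra.
  apply: (@le_trans _ _ (`|x * normal_pdf 0 1 x| * (r ^+ 2 * x ^+ 2))).
    by rewrite ler_wpM2l.
  rewrite mulrCA mulrC ler_wpM2r ?sqr_ge0//.
  rewrite -(ger0_norm (sqr_ge0 x)) -normrM.
  have := normal_pdf3_bound x; rewrite -/K; congr (`|_| <= _); ring.
(* The first-order terms nearly cancel: with [t = r^2 - 1], the bracket has a double zero at
   [r = 1], and its cofactor [(r + 2) / (2 r)] is at most [3 / 2]. *)
have B : `|w * normal_pdf 0 1 w * (1 / r - 1 + t / 2)| <= K * (3 / 2 * (r - 1) ^+ 2).
  rewrite normrM ler_pM ?normal_pdf1_bound//.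
  have -> : 1 / r - 1 + t / 2 = (r - 1) ^+ 2 * ((r + 2) / (2 * r)).
    have -> : t = r ^+ 2 - 1 by rewrite r2; ring.
    by field.
  rewrite ger0_norm; last by rewrite mulr_ge0 ?sqr_ge0// divr_ge0//; lra.
  by rewrite mulrC ler_wpM2r ?sqr_ge0// ler_pdivrMr; lra.
rewrite (_ : _ + _ =
   (ncdf 1 (w / r) - ncdf 1 w - normal_pdf 0 1 w * (w / r - w)) +
   w * normal_pdf 0 1 w * (1 / r - 1 + t / 2)); last by field.
rewrite (le_trans (ler_normD _ _))// (le_trans (lerD T B))//.
rewrite -mulrDr ler_wpM2l//; move: rt; set y := (r - 1) ^+ 2.
have := sqr_ge0 t; lra.
Qed.

(* A centered two-point step of variance [g^2 (1 - u^2)] is replaced by a normal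
   step of variance [g^2]. *)
Lemma normal_one_step {R : realType} (w g u : R) : 0 <= g -> -1 <= u <= 1 ->
  `|(1 + u) / 2 * ncdf 1 (w - g * (1 - u)) +
    (1 - u) / 2 * ncdf 1 (w + g * (1 + u)) - ncdf 1 (w / Num.sqrt (1 + g ^+ 2))|
    <= 32 * normal_peak 1 * (g ^+ 3 + g ^+ 2 * u ^+ 2 + g ^+ 4).
Proof.
move=> g0 /andP[u1 u2].
pose K : R := 4 * normal_peak 1.
have K0 : 0 <= K by rewrite mulr_ge0// normal_peak_ge0.
have T h := taylor2_bound _ _ _ _ w h K
  (fun x => is_derive_ncdf 1 x (oner_neq0 _)) is_derive_normal_pdf
  is_derive_normal_pdf1 normal_pdf2_bound.
have S := ncdf_shrink w (g ^+ 2) (sqr_ge0 g); rewrite -/K in S.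
have M := normal_pdf1_bound w; rewrite -/K in M.
have {T}T h : `|h| <= 2 * g ->
    `|ncdf 1 (w + h) - ncdf 1 w - normal_pdf 0 1 w * h -
      - (w * normal_pdf 0 1 w) * h ^+ 2 / 2| <= 8 * K * g ^+ 3.
  move=> hg; apply: le_trans (T h) _.
  rewrite (_ : 8 * K * g ^+ 3 = K * (2 * g) ^+ 3); last by ring.
  by rewrite ler_wpM2l// lerXn2r ?nnegrE// mulr_ge0.
have T1 := T (- (g * (1 - u))); have T2 := T (g * (1 + u)).
rewrite normrN ger0_norm in T1; last by rewrite mulr_ge0//; lra.
rewrite ger0_norm in T2; last by rewrite mulr_ge0//; lra.
have {}T1 := T1 ltac:(nra); have {}T2 := T2 ltac:(nra).
move: T1 T2 S M.
set P := w * normal_pdf 0 1 w; set p := normal_pdf 0 1 w.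
set a := ncdf 1 (w - _); set b := ncdf 1 (w + _).
set c := ncdf 1 (w / _); set d := ncdf 1 w => T1 T2 S M.
(* The two increments have weighted mean [0] and weighted mean square [g^2 (1 - u^2)]: the linear
   Taylor terms cancel, and the quadratic ones match the heat term up to [P * (g^2 u^2 / 2)]. *)
rewrite (_ : _ - c =
  (1 + u) / 2 *
    (a - d - p * - (g * (1 - u)) - - P * (- (g * (1 - u))) ^+ 2 / 2)
  + (1 - u) / 2 * (b - d - p * (g * (1 + u)) - - P * (g * (1 + u)) ^+ 2 / 2)
  - (c - d + P * g ^+ 2 / 2) + P * (g ^+ 2 * u ^+ 2 / 2)); last by field.
have U1 : 0 <= (1 + u) / 2 by lra.
have U2 : 0 <= (1 - u) / 2 by lra.
rewrite (le_trans (ler_normD _ _))// (le_trans (lerD (ler_normB _ _) (lexx _)))//.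
rewrite (le_trans (lerD (lerD (ler_normD _ _) (lexx _)) (lexx _)))//.
rewrite (normrM ((1 + u) / 2)) (normrM ((1 - u) / 2)).
rewrite (ger0_norm U1) (ger0_norm U2).
have gu : 0 <= g ^+ 2 * u ^+ 2 / 2.
  exact: divr_ge0 (mulr_ge0 (sqr_ge0 g) (sqr_ge0 u)) (ler0n _ 2).
rewrite (normrM P) (ger0_norm gu).
have V1 := ler_wpM2l U1 T1; have V2 := ler_wpM2l U2 T2.
have V3 := ler_wpM2r gu M.
have V4 := mulr_ge0 K0 gu.
have V5 : 0 <= K * g ^+ 4 by rewrite mulr_ge0// exprn_ge0.
move: V1 V2 S V3 V4 V5; rewrite -exprM.
rewrite (_ : 32 * normal_peak 1 = 8 * K); last by rewrite /K; ring.
set A1 := `|a - _ - _ - _|; set A2 := `|b - _ - _ - _|; set A3 := `|c - _ + _|.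
move=> V1 V2 S' V3 V4 V5; lra.
Qed.

(** * The mean operator of the walk *)

Definition walk_step {R : realType} (a m : R) (h : R -> R) (s : R) : R :=
  (1 + a * (s / m)) / 2 * h (s + 1) + (1 - a * (s / m)) / 2 * h (s - 1).

(** The index is shifted by one: [walk_mean a n h] stands for the mean of [h] at time [n + 1], the
    base case being the deterministic first step. The last step is peeled off first, acting on the
    test function. *)
Fixpoint walk_mean {R : realType} (a : R) (n : nat) (h : R -> R) : R :=
  if n is n'.+1 then walk_mean a n' (walk_step a n%:R h) else h 1.

Lemma eq_walk_mean {R : realType} (a : R) n (h g : R -> R) :
  h =1 g -> walk_mean a n h = walk_mean a n g.
Proof. by move=> /funext ->. Qed.

Lemma walk_mean_linear {R : realType} (a x y : R) n (h g : R -> R) :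
  walk_mean a n (fun s => x * h s + y * g s) =
  x * walk_mean a n h + y * walk_mean a n g.
Proof.
elim: n h g => [|n IH] h g //=; rewrite -IH; apply: eq_walk_mean => s.
by rewrite /walk_step; ring.
Qed.

Lemma walk_meanZ {R : realType} (a x : R) n (h : R -> R) :
  walk_mean a n (fun s => x * h s) = x * walk_mean a n h.
Proof.
rewrite -[RHS]addr0 -[X in _ + X](mul0r (walk_mean a n h)) -walk_mean_linear.
by apply: eq_walk_mean => s; rewrite mul0r addr0.
Qed.

Lemma walk_mean_cst {R : realType} (a c : R) n : walk_mean a n (fun=> c) = c.
Proof.
elim: n => [//|n IH] /=; rewrite -[RHS]IH; apply: eq_walk_mean => s.
by rewrite /walk_step; field; rewrite nat1r pnatr_eq0.
Qed.

Lemma walk_mean_sum {R : realType} (a : R) n (I : Type) (r : seq I)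
  (F : I -> R -> R) :
  walk_mean a n (fun s => \sum_(i <- r) F i s) =
  \sum_(i <- r) walk_mean a n (F i).
Proof.
elim: r => [|i r IH].
  rewrite big_nil -[RHS](walk_mean_cst a 0 n); apply: eq_walk_mean => s.
  by rewrite big_nil.
rewrite big_cons -IH -[X in X + _]mul1r -[X in _ + X]mul1r -walk_mean_linear.
by apply: eq_walk_mean => s; rewrite big_cons !mul1r.
Qed.

Lemma drift_le1 {R : realType} (a s m : R) : 0 < m -> -1 <= a <= 1 ->
  `|s| <= m -> -1 <= a * (s / m) <= 1.
Proof.
move=> m0 a1 sm; rewrite -ler_norml normrM normrM normfV (gtr0_norm m0).
by apply: mulr_ile1; rewrite ?divr_ge0 ?(ltW m0) ?ler_norml// ler_pdivrMr ?mul1r.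
Qed.

(** Both weights of [walk_step] are nonnegative on the range [|s| <= n] of the walk at time [n];
    beyond it a weight may be negative, so the comparison is confined to that range. *)
Lemma ler_walk_mean {R : realType} (a : R) n (h g : R -> R) : -1 <= a <= 1 ->
  (forall s, `|s| <= n.+1%:R -> h s <= g s) ->
  walk_mean a n h <= walk_mean a n g.
Proof.
move=> a1; elim: n h g => [|n IH] h g hg; first by rewrite /= hg// normr1.
apply: IH => s sn.
have n0 : 0 < (n.+1%:R : R) by [].
have /andP[u1 u2] := drift_le1 a s n.+1%:R n0 a1 sn.
rewrite /walk_step; move: (a * (s / _)) u1 u2 => u u1 u2.
apply: lerD; apply: ler_wpM2l; try lra.
  by rewrite hg// -natr1 (le_trans (ler_normD _ _))// normr1 lerD2r.
by rewrite hg// -natr1 (le_trans (ler_normB _ _))// normr1 lerD2r.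
Qed.

Lemma walk_mean_dist {R : realType} (a : R) n (h g e : R -> R) : -1 <= a <= 1 ->
  (forall s, `|s| <= n.+1%:R -> `|h s - g s| <= e s) ->
  `|walk_mean a n h - walk_mean a n g| <= walk_mean a n e.
Proof.
move=> a1 hge.
have E : walk_mean a n h - walk_mean a n g = walk_mean a n (fun s => h s - g s).
  rewrite -[X in X - _]mul1r -mulN1r -walk_mean_linear.
  by apply: eq_walk_mean => s; rewrite mul1r mulN1r.
have N : - walk_mean a n e = walk_mean a n (fun s => - e s).
  rewrite -mulN1r -[LHS]addr0 -(mul0r (walk_mean a n e)) -walk_mean_linear.
  by apply: eq_walk_mean => s; rewrite mul0r mulN1r addr0.
rewrite E ler_norml N; apply/andP; split; apply: ler_walk_mean => // s /hge;
  by rewrite ler_norml => /andP[].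
Qed.

Lemma eq_cvg_to {T : Type} {U : topologicalType} (F : set_system T)
  (f g : T -> U) (l : U) :
  f =1 g -> f @ F --> l -> g @ F --> l.
Proof. by move=> /funext ->. Qed.

(** Undoing the step from [n] to [n + 1] multiplies [g] by [1 + a / n], hence [g ^+ k] by its [k]-th
    power: [k = 1] carries the mean, [k = 2] the variance and the quadratic errors, [k = 4] the
    quartic errors. *)
Fixpoint growth {R : realType} (a : R) (k : nat) (x0 : R) (e : nat -> R) n : R :=
  if n is n'.+1 then (1 + a / n%:R) ^+ k * growth a k x0 e n' + e n' else x0.

Definition walk_msq {R : realType} (a : R) n : R := walk_mean a n (fun s => s ^+ 2).

Lemma walk_mean_id {R : realType} (a : R) n :
  walk_mean a n id = growth a 1 1 (fun=> 0) n.
Proof.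
elim: n => [//|n IH] /=; rewrite -IH expr1 addr0 -walk_meanZ.
apply: eq_walk_mean => s; rewrite /walk_step; field.
by rewrite nat1r pnatr_eq0.
Qed.

Lemma walk_msqS {R : realType} (a : R) n :
  walk_msq a n.+1 = (1 + 2 * a / n.+1%:R) * walk_msq a n + 1.
Proof.
rewrite /walk_msq /= -[X in _ + X](walk_mean_cst a 1 n) -[X in _ + X]mul1r.
rewrite -walk_mean_linear; apply: eq_walk_mean => s; rewrite /walk_step; field.
by rewrite nat1r pnatr_eq0.
Qed.

Lemma walk_msq_ge0 {R : realType} (a : R) n : -1 <= a <= 1 -> 0 <= walk_msq a n.
Proof.
move=> a1; rewrite -[leLHS](walk_mean_cst a 0 n).
by apply: ler_walk_mean => // s _; exact: sqr_ge0.
Qed.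

(* [growth a 2 0 (fun=> 1)] is the variance gained along the recursion; the
   other two sequences accumulate the errors of the single steps. *)
Lemma walk_mean_ncdf {R : realType} (a v0 eta z : R) n (g v : R) :
  -1 <= a <= 1 -> 0 < v0 -> 0 < eta -> 0 <= g -> v0 <= v ->
  `|walk_mean a n (fun s => ncdf 1 ((z - g * s) / Num.sqrt v)) -
    ncdf 1 ((z - g * growth a 1 1 (fun=> 0) n) /
             Num.sqrt (v + g ^+ 2 * growth a 2 0 (fun=> 1) n))|
  <= 32 * normal_peak 1 *
     (g ^+ 2 / v0 * (eta * growth a 2 0 (fun=> 1) n +
                     growth a 2 0 (fun k => walk_msq a k / k.+1%:R ^+ 2) n) +
      g ^+ 4 / v0 ^+ 2 * ((1 + eta^-1) * growth a 4 0 (fun=> 1) n)).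
Proof.
move=> a1 v00 eta0; set K := 32 * _.
have K0 : 0 <= K by rewrite mulr_ge0// normal_peak_ge0.
have one := @normal_one_step R; rewrite -/K in one; clearbody K.
(* Both [g] and [v] are generalised, since each undone step changes them to [g * c] and
   [v + g ^+ 2]. *)
elim: n g v => [|n IH] g v g0 vv0.
  by rewrite /= !mulr0 !addr0 !mulr0 subrr normr0.
set m : R := n.+1%:R.
have m0 : 0 < m by rewrite ltr0n.
set c := 1 + a / m.
have c0 : 0 <= c.
  rewrite /c (_ : 1 + a / m = (m + a) / m); last by field; rewrite gt_eqF.
  rewrite divr_ge0 ?(ltW m0)//.
  have m1 : 1 <= m by rewrite ler1n.
  by case/andP: a1; lra.
have gc0 : 0 <= g * c by rewrite mulr_ge0.
have vv : v0 <= v + g ^+ 2 by rewrite (le_trans vv0)// lerDl sqr_ge0.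
have H := IH (g * c) (v + g ^+ 2) gc0 vv.
have v_gt0 : 0 < v by apply: lt_le_trans vv0.
have S s : `|s| <= m ->
  `|walk_step a m (fun s => ncdf 1 ((z - g * s) / Num.sqrt v)) s -
    ncdf 1 ((z - g * c * s) / Num.sqrt (v + g ^+ 2))| <=
  (K * (g ^+ 2 / v0)) / m ^+ 2 * s ^+ 2 +
   K * (g ^+ 2 / v0 * eta + g ^+ 4 / v0 ^+ 2 * (1 + eta^-1)) * 1.
  move=> sm; set u := a * (s / m).
  have u1 : -1 <= u <= 1 by apply: drift_le1.
  (* After division by [Num.sqrt v] the step has size [q], and [w] sits at the drifted position:
     [w - q (1 - u)] and [w + q (1 + u)] are the arguments reached from [s + 1] and [s - 1]. *)
  set q := g / Num.sqrt v; set w := (z - g * c * s) / Num.sqrt v.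
  have sv0 : 0 < Num.sqrt v by rewrite sqrtr_gt0.
  have q0 : 0 <= q by rewrite divr_ge0// sqrtr_ge0.
  have := one w q u q0 u1.
  have -> : w - q * (1 - u) = (z - g * (s + 1)) / Num.sqrt v.
    by rewrite /w /q /u /c; field; rewrite !gt_eqF.
  have -> : w + q * (1 + u) = (z - g * (s - 1)) / Num.sqrt v.
    by rewrite /w /q /u /c; field; rewrite !gt_eqF.
  have -> : w / Num.sqrt (1 + q ^+ 2) = (z - g * c * s) / Num.sqrt (v + g ^+ 2).
    have -> : v + g ^+ 2 = v * (1 + q ^+ 2).
      rewrite /q exprMn exprVn sqr_sqrtr ?ltW//; field; by rewrite gt_eqF.
    by rewrite sqrtrM ?ltW// /w invfM mulrA.
  move=> /le_trans; apply.
  rewrite (_ : _ + _ * 1 = K * ((g ^+ 2 / v0) * (s ^+ 2 / m ^+ 2) +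
    (eta * (g ^+ 2 / v0) + g ^+ 4 / v0 ^+ 2 * (1 + eta^-1)))); last first.
    by field; rewrite !gt_eqF.
  rewrite ler_wpM2l//.
  have q2 : q ^+ 2 <= g ^+ 2 / v0.
    rewrite /q exprMn exprVn sqr_sqrtr ?(ltW v_gt0)// ler_wpM2l ?sqr_ge0//.
    by rewrite lef_pV2 ?posrE.
  have q4 : q ^+ 4 <= g ^+ 4 / v0 ^+ 2.
    rewrite (_ : q ^+ 4 = (q ^+ 2) ^+ 2); last by rewrite -exprM.
    rewrite (_ : g ^+ 4 / v0 ^+ 2 = (g ^+ 2 / v0) ^+ 2); last first.
      by rewrite exprMn exprVn -exprM.
    by rewrite lerXn2r// nnegrE ?sqr_ge0// divr_ge0 ?sqr_ge0 ?(ltW v00).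
  have u2 : u ^+ 2 <= s ^+ 2 / m ^+ 2.
    rewrite -expr_div_n /u exprMn ler_piMl ?sqr_ge0//.
    by case/andP: a1; nra.
  (* AM-GM trades the third-order Taylor error for even powers. *)
  have q3 : q ^+ 3 <= eta * q ^+ 2 + eta^-1 * q ^+ 4.
    have : 0 <= eta^-1 * (q ^+ 2 * (eta - q) ^+ 2).
      by apply: mulr_ge0; [rewrite invr_ge0 ltW|apply: mulr_ge0; exact: sqr_ge0].
    have -> : eta^-1 * (q ^+ 2 * (eta - q) ^+ 2) =
       eta * q ^+ 2 + eta^-1 * q ^+ 4 - 2 * q ^+ 3.
      by field; rewrite gt_eqF.
    have : 0 <= q ^+ 3 by rewrite exprn_ge0.
    lra.
  have e0 : 0 <= 1 + eta^-1 by rewrite addr_ge0// invr_ge0 ltW.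
  have T1 : q ^+ 2 * u ^+ 2 <= (g ^+ 2 / v0) * (s ^+ 2 / m ^+ 2).
    by rewrite ler_pM ?sqr_ge0.
  have T2 := ler_wpM2l (ltW eta0) q2.
  have T3 := ler_wpM2r e0 q4.
  rewrite mulrDr mulr1 (mulrC (q ^+ 4)) in T3.
  move: q3 T1 T2 T3; move: (q ^+ 3) (q ^+ 2 * u ^+ 2) (eta * q ^+ 2) (q ^+ 4)
    (_ * (s ^+ 2 / _)) (eta * (_ / v0)) (_ * (1 + eta^-1)) => x1 x2 x3 x4 x5 x6 x7.
  move: (eta^-1 * x4) => x8; lra.
(* Averaging the pointwise bound turns its [s ^+ 2] into [walk_msq a n]. *)
have D := walk_mean_dist a n _ _ _ a1 S.
have e1 : g * growth a 1 1 (fun=> 0) n.+1 = g * c * growth a 1 1 (fun=> 0) n.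
  by rewrite /= -/m -/c; ring.
have e2 : v + g ^+ 2 * growth a 2 0 (fun=> 1) n.+1 =
    v + g ^+ 2 + (g * c) ^+ 2 * growth a 2 0 (fun=> 1) n.
  by rewrite /= -/m -/c; ring.
rewrite e1 e2 [walk_mean a n.+1 _]/= -/m.
apply: (le_trans (ler_distD (walk_mean a n (fun s =>
  ncdf 1 ((z - g * c * s) / Num.sqrt (v + g ^+ 2)))) _ _)).
apply: le_trans (lerD D H) _.
rewrite walk_mean_linear walk_mean_cst -/(walk_msq _ _) /= -/m -/c.
rewrite le_eqVlt; apply/orP; left; apply/eqP; field.
by rewrite !gt_eqF.
Qed.

Lemma drift_ge0 {R : realType} (a : R) n : -1 <= a <= 1 -> 0 <= 1 + a / n.+1%:R.
Proof.
move=> a1; rewrite (_ : 1 + _ = (n.+1%:R + a) / n.+1%:R); last first.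
  by field; rewrite nat1r pnatr_eq0.
rewrite divr_ge0//; have : (1 : R) <= n.+1%:R by rewrite ler1n.
by case/andP: a1; lra.
Qed.

(** * Asymptotics of the moment and error recursions *)

Section asymptotics.
Context {R : realType} (a : R).
Hypotheses (a1 : -1 <= a <= 1) (a2 : a < 1 / 2).

(** The square of the mean obeys the unforced recursion with factor [(1 + a / n)^2]. *)
Lemma walk_mean_id_cvg0 :
  walk_mean a n id / Num.sqrt n.+1%:R @[n --> \oo] --> (0 : R).
Proof.
have H : (walk_mean a n id) ^+ 2 / n.+1%:R @[n --> \oo] --> (0 : R).
  apply: (growth_cvg0 a _ (fun=> 0) a2); first exact: cvg_cst.
  near=> n; rewrite !walk_mean_id /= addr0 expr1 !normrX normrM addr0 exprMn.
  by rewrite (ger0_norm (drift_ge0 _ _ a1)).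
apply/cvgrPdist_lt => e e0; move/cvgrPdist_lt : H => /(_ (e ^+ 2)).
rewrite exprn_gt0// => /(_ isT); apply: filterS => n.
rewrite !sub0r !normrN normrM normrX normfV normr_nat => h.
rewrite -(ltr_pXn2r (n := 2)) ?nnegrE ?(ltW e0)//.
by rewrite normrM normfV exprMn exprVn (ger0_norm (sqrtr_ge0 _)) sqr_sqrtr.
Unshelve. all: by end_near. Qed.

(** With [k = 1 / (1 - 2 a)], the sequence [k (n + 1)] solves the recursion exactly; the difference
    is unforced, with factor [1 + 2 a / m <= (1 + a / m)^2]. *)
Lemma walk_msq_cvg : walk_msq a n / n.+1%:R @[n --> \oo] --> (1 - 2 * a)^-1.
Proof.
set k := _^-1.
have k0 : 1 - 2 * a != 0 by rewrite gt_eqF// subr_gt0; move: a2; lra.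
have H : (walk_msq a n - k * n.+1%:R) / n.+1%:R @[n --> \oo] --> (0 : R).
  apply: (growth_cvg0 a _ (fun=> 0) a2); first exact: cvg_cst.
  near=> n; rewrite walk_msqS addr0.
  have n0 : n.+1%:R != 0 :> R by [].
  have -> : (1 + 2 * a / n.+1%:R) * walk_msq a n + 1 - k * n.+2%:R =
     (1 + 2 * a / n.+1%:R) * (walk_msq a n - k * n.+1%:R).
    by rewrite -(natr1 n.+1) /k; field; rewrite k0 nat1r pnatr_eq0.
  rewrite normrM ler_wpM2r//.
  (* Makes [1 + 2 a / (n + 1)] nonnegative even for [a = -1]. *)
  have n2 : 2 <= n.+1%:R :> R.
    by rewrite (ler_nat _ 2); near: n; by exists 1%N.
  rewrite ger0_norm; last first.
    rewrite (_ : 1 + _ = (n.+1%:R + 2 * a) / n.+1%:R); last first.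
      by field; rewrite nat1r pnatr_eq0.
    by rewrite divr_ge0//; case/andP: a1; lra.
  by rewrite -subr_ge0 (_ : _ - _ = (a / n.+1%:R) ^+ 2) ?sqr_ge0//; ring.
rewrite -[k]add0r; apply: eq_cvg_to (cvgD H (cvg_cst k)) => n.
by rewrite !fctE /= mulrBl mulfK ?subrK.
Unshelve. all: by end_near. Qed.

(** Here [k (n + 1)] is only an approximate solution, leaving the vanishing forcing
    [k a^2 / (n + 1)]. *)
Lemma growth2_cvg :
  growth a 2 0 (fun=> 1) n / n.+1%:R @[n --> \oo] --> (1 - 2 * a)^-1.
Proof.
set k := _^-1.
have k0 : 1 - 2 * a != 0 by rewrite gt_eqF// subr_gt0; move: a2; lra.
have H : (growth a 2 0 (fun=> 1) n - k * n.+1%:R) / n.+1%:R @[n --> \oo] -->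
    (0 : R).
  apply: (growth_cvg0 a _ (fun n => `|k * a ^+ 2| / n.+1%:R) a2).
    rewrite -[X in _ --> X](mulr0 `|k * a ^+ 2|).
    by apply: cvgM; [exact: cvg_cst|exact: invSn_cvg0].
  near=> n; rewrite /=.
  have -> : (1 + a / n.+1%:R) ^+ 2 * growth a 2 0 (fun=> 1) n + 1 - k * n.+2%:R =
     (1 + a / n.+1%:R) ^+ 2 * (growth a 2 0 (fun=> 1) n - k * n.+1%:R)
     + k * a ^+ 2 / n.+1%:R.
    by rewrite -(natr1 n.+1) /k; field; rewrite k0 nat1r pnatr_eq0.
  rewrite (le_trans (ler_normD _ _))// (normrM (_ ^+ 2)) normrX (normrM (k * _)).
  by rewrite (ger0_norm (drift_ge0 _ _ a1)) normfV normr_nat.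
rewrite -[k]add0r; apply: eq_cvg_to (cvgD H (cvg_cst k)) => n.
by rewrite !fctE /= mulrBl mulfK ?subrK.
Unshelve. all: by end_near. Qed.

(** The mean square grows linearly, so the forcing is of order [1 / n] and tends to [0]. *)
Lemma growth_msq_cvg :
  growth a 2 0 (fun k => walk_msq a k / k.+1%:R ^+ 2) n / n.+1%:R @[n --> \oo]
    --> (0 : R).
Proof.
apply: (growth_cvg0 a _ (fun k => walk_msq a k / k.+1%:R ^+ 2) a2).
  rewrite -(mulr0 (1 - 2 * a)^-1).
  apply: eq_cvg_to (cvgM walk_msq_cvg (@invSn_cvg0 R)) => n.
  by rewrite ?fctE /= -mulrA -invfM -expr2.
near=> n; rewrite /= (le_trans (ler_normD _ _))// normrM normrX.
rewrite (ger0_norm (drift_ge0 _ _ a1)) lerD2l ger0_norm//.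
by rewrite divr_ge0 ?walk_msq_ge0// sqr_ge0.
Unshelve. all: by end_near. Qed.

(** One division by the index absorbs two of the four factors, because
    [(n + 1) (1 + a / (n + 1))^2 <= n + 2] eventually; the quotient then obeys the recursion with
    exponent two. *)
Lemma growth4_cvg :
  growth a 4 0 (fun=> 1) n / n.+1%:R ^+ 2 @[n --> \oo] --> (0 : R).
Proof.
have H : (growth a 4 0 (fun=> 1) n / n.+1%:R) / n.+1%:R @[n --> \oo] -->
    (0 : R).
  apply: (growth_cvg0 a _ (fun n => n.+2%:R^-1) a2).
    by rewrite (cvg_shiftS (fun n => n.+1%:R^-1 : R)); exact: invSn_cvg0.
  have c0 : 0 < 1 - 2 * a by move: a2; lra.
  have H : \forall n \near \oo, a ^+ 2 / n.+1%:R <= 1 - 2 * a.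
    have /(cvgM (cvg_cst (a ^+ 2))) := @invSn_cvg0 R.
    rewrite mulr0 => /cvgrPdist_le /(_ _ c0).
    by apply: filterS => n; rewrite sub0r normrN; apply: le_trans; exact: ler_norm.
  near=> n.
  have h : a ^+ 2 / n.+1%:R <= 1 - 2 * a by near: n.
  rewrite /= mulrDl mul1r (le_trans (ler_normD _ _))//.
  rewrite (@ger0_norm _ (n.+2%:R^-1))// lerD2r.
  set F := growth _ _ _ _ _.
  rewrite (_ : _ / n.+2%:R = ((1 + a / n.+1%:R) ^+ 2 * (F / n.+1%:R)) *
     ((n.+1%:R + 2 * a + a ^+ 2 / n.+1%:R) / n.+2%:R)); last first.
    by rewrite -(natr1 n.+1); field; rewrite nat1r natr1 !pnatr_eq0.
  have n1 : (1 : R) <= n.+1%:R by rewrite ler1n.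
  have a0 : 0 <= a ^+ 2 / n.+1%:R by rewrite divr_ge0 ?sqr_ge0.
  rewrite normrM normrM normrX (ger0_norm (drift_ge0 _ _ a1)).
  rewrite ler_piMr ?(mulr_ge0 (sqr_ge0 _))//.
  rewrite ger0_norm; last first.
    rewrite divr_ge0//; rewrite (_ : _ + _ = n.+1%:R * (1 + a / n.+1%:R) ^+ 2).
      by rewrite mulr_ge0// sqr_ge0.
    by field; rewrite nat1r pnatr_eq0.
  rewrite ler_pdivrMr// mul1r -(natr1 n.+1).
  by move: (a ^+ 2 / _) h a0 => t; lra.
apply: eq_cvg_to H => n; by rewrite -mulrA -invfM -expr2.
Unshelve. all: by end_near. Qed.
End asymptotics.

(** * The central limit theorem for the walk *)

Lemma continuous_ncdf_ratio {R : realType} (T : Type) (F : set_system T)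
  {FF : Filter F} (x y : T -> R) (l m : R) : 0 < m ->
  x @ F --> l -> y @ F --> m ->
  ncdf 1 (x t / Num.sqrt (y t)) @[t --> F] --> ncdf 1 (l / Num.sqrt m).
Proof.
move=> m0 xl ym.
apply: (@cvg_comp _ _ _ (fun t => x t / Num.sqrt (y t)) (ncdf 1)); last first.
  by apply: continuous_ncdf; exact: oner_neq0.
apply: cvgM => //; apply: cvgV; first by rewrite gt_eqF// sqrtr_gt0.
by apply: (@cvg_comp _ _ _ y Num.sqrt _ _ _ ym); exact: sqrt_continuous.
Qed.

Section clt.
Context {R : realType} (a : R).
Hypotheses (a1 : -1 <= a <= 1) (a2 : a < 1 / 2).

Let kappa := (1 - 2 * a)^-1.

Let kappa_gt0 : 0 < kappa.
Proof. by rewrite invr_gt0; move: a2; lra. Qed.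

Lemma walk_mean_ncdf_cvg (z v : R) : 0 < v ->
  walk_mean a n (fun s => ncdf 1 ((z - s / Num.sqrt n.+1%:R) / Num.sqrt v))
    @[n --> \oo] --> ncdf 1 (z / Num.sqrt (v + kappa)).
Proof.
move=> v0.
pose g n : R := (Num.sqrt n.+1%:R)^-1.
pose A n := growth a 2 0 (fun=> 1) n.
pose D n := growth a 2 0 (fun k => walk_msq a k / k.+1%:R ^+ 2) n.
pose F n := growth a 4 0 (fun=> 1) n.
have g2 n : g n ^+ 2 = n.+1%:R^-1 by rewrite /g exprVn sqr_sqrtr.
pose W n :=
  walk_mean a n (fun s => ncdf 1 ((z - s / Num.sqrt n.+1%:R) / Num.sqrt v)).
(* The outcome of replacing all the steps; it already has the required limit, so only the
   replacement error remains. *)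
pose L n := ncdf 1 ((z - walk_mean a n id / Num.sqrt n.+1%:R) /
   Num.sqrt (v + A n / n.+1%:R)).
have LE : L n @[n --> \oo] --> ncdf 1 (z / Num.sqrt (v + kappa)).
  apply: continuous_ncdf_ratio; first by rewrite addr_gt0.
    rewrite -[X in _ --> X]subr0; apply: cvgB; first exact: cvg_cst.
    exact: walk_mean_id_cvg0.
  by apply: cvgD; [exact: cvg_cst|exact: growth2_cvg].
suff WL : W n - L n @[n --> \oo] --> (0 : R).
  rewrite -[X in _ --> X]add0r; apply: eq_cvg_to (cvgD WL LE) => n.
  by rewrite !fctE /= subrK.
pose K : R := 32 * normal_peak 1.
have K0 : 0 <= K by rewrite mulr_ge0// normal_peak_ge0.
apply/cvgrPdist_lt => e e0.
(* Makes the limit [K * eta * kappa / v] of the error bound at most [e / 2]; the added [1] keeps the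
   denominator positive. *)
pose eta := e * v / (2 * (K * kappa + 1)).
have Kk : 0 < K * kappa + 1 by rewrite ltr_wpDl// mulr_ge0// ltW.
have eta0 : 0 < eta by rewrite divr_gt0 ?mulr_gt0.
pose B n := K * (v^-1 * (eta * (A n / n.+1%:R) + D n / n.+1%:R) +
   (v ^+ 2)^-1 * ((1 + eta^-1) * (F n / n.+1%:R ^+ 2))).
have BE : B n @[n --> \oo] --> K * (v^-1 * (eta * kappa + 0) +
   (v ^+ 2)^-1 * ((1 + eta^-1) * 0)).
  apply: cvgM; first exact: cvg_cst.
  apply: cvgD; (apply: cvgM; first exact: cvg_cst).
    apply: cvgD; last exact: growth_msq_cvg.
    by apply: cvgM; [exact: cvg_cst|exact: growth2_cvg].
  by apply: cvgM; [exact: cvg_cst|exact: growth4_cvg].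
have Be : \forall n \near \oo, B n < e.
  apply: (cvgr_lt _ BE).
  rewrite addr0 !mulr0 addr0 /eta.
  have -> : K * (v^-1 * (e * v / (2 * (K * kappa + 1)) * kappa)) =
      e / 2 * ((K * kappa) / (K * kappa + 1)).
    move: (kappa) Kk => q Kq; by field; rewrite !gt_eqF.
  rewrite (@le_lt_trans _ _ (e / 2))//; last by lra.
  by rewrite ler_piMr ?divr_ge0 ?(ltW e0)// ler_pdivrMr// mul1r lerDl.
apply: filterS Be => n; apply: le_lt_trans.
rewrite sub0r normrN.
have := walk_mean_ncdf a v eta z n (g n) v a1 v0 eta0.
rewrite invr_ge0 sqrtr_ge0 lexx => /(_ isT isT).
have g4 : g n ^+ 4 = n.+1%:R^-1 ^+ 2 by rewrite -g2 -exprM.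
rewrite g4 g2 -walk_mean_id => H.
have -> : W n = walk_mean a n (fun s => ncdf 1 ((z - g n * s) / Num.sqrt v)).
  by apply: eq_walk_mean => s; rewrite (mulrC s).
have -> : L n = ncdf 1 ((z - g n * walk_mean a n id) /
   Num.sqrt (v + n.+1%:R^-1 * A n)).
  by rewrite /L (mulrC (walk_mean _ _ _)) (mulrC (A n)).
apply: le_trans H _; rewrite -/K /B -/(A n) -/(D n) -/(F n) le_eqVlt.
by apply/orP; left; apply/eqP; field; rewrite nat1r pnatr_eq0 !gt_eqF.
Unshelve. all: by end_near. Qed.

(** The bounds on [h] admit the indicators of both [x < z] and [x <= z]; the strict one serves the
    negative values of the random factor. *)
Lemma walk_mean_cdf_cvg (z : R) (h : R -> R) :
  (forall x, (x < z)%R%:R <= h x <= (x <= z)%R%:R) ->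
  walk_mean a n (fun s => h (s / Num.sqrt n.+1%:R)) @[n --> \oo] -->
  ncdf (Num.sqrt kappa) z.
Proof.
move=> hz; rewrite ncdf_scale ?sqrtr_gt0// mulrC.
set L := ncdf 1 _.
(* The indicator is sandwiched between normal distribution functions shifted by [t] with standard
   deviation [t^2]: the shift tends to [0] while its ratio [1 / t] to the deviation tends to
   infinity. *)
pose t k : R := k.+1%:R^-1.
have t0 k : 0 < t k by rewrite invr_gt0 ltr0n.
have tc : t k @[k --> \oo] --> (0 : R) by exact: invSn_cvg0.
have N1 : ncdf 1 (t k)^-1 @[k --> \oo] --> (1 : R).
  apply: (@cvg_comp _ _ _ (fun k => (t k)^-1) (ncdf 1) _ +oo);
    last exact: cvg_ncdfy.
  apply/cvgryPge => A; near=> k; rewrite /t invrK (@le_trans _ _ k%:R)//.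
    by near: k; exact: nbhs_infty_ger.
  by rewrite ler_nat.
pose V c k := ncdf 1 ((z + c * t k) / Num.sqrt (t k ^+ 4 + kappa)).
have base c : V c k @[k --> \oo] --> L.
  apply: continuous_ncdf_ratio => //.
    rewrite -[X in _ --> X]addr0 -(mulr0 c); apply: cvgD; first exact: cvg_cst.
    by apply: cvgM => //; exact: cvg_cst.
  rewrite -[X in _ --> X]add0r; apply: cvgD; last exact: cvg_cst.
  rewrite (_ : 0 = (0 : R) ^+ 4); last by rewrite expr0n.
  by apply: (@cvg_comp _ _ _ t (fun x => x ^+ 4) _ _ _ tc); exact: exprn_continuous.
have up : V 1 k + (1 - ncdf 1 (t k)^-1) @[k --> \oo] --> L.
  rewrite -[X in _ --> X]addr0 -(subrr 1); apply: cvgD => //.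
  by apply: cvgB => //; exact: cvg_cst.
have lo : V (-1) k - (1 - ncdf 1 (t k)^-1) @[k --> \oo] --> L.
  rewrite -[X in _ --> X]subr0 -(subrr 1); apply: cvgB => //.
  by apply: cvgB => //; exact: cvg_cst.
apply/cvgrPdist_lt => e e0.
have e2 : 0 < e / 2 by rewrite divr_gt0.
(* The smoothing is fixed here, before [n] tends to infinity. *)
have [k [ku kl]] : exists k,
   `|L - (V 1 k + (1 - ncdf 1 (t k)^-1))| < e / 2 /\
   `|L - (V (-1) k - (1 - ncdf 1 (t k)^-1))| < e / 2.
  move/cvgrPdist_lt : up => /(_ _ e2) up.
  move/cvgrPdist_lt : lo => /(_ _ e2) lo.
  near \oo => k; exists k; split; near: k; [exact: up|exact: lo].
have st : Num.sqrt (t k ^+ 4) = t k ^+ 2.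
  rewrite (_ : t k ^+ 4 = (t k ^+ 2) ^+ 2); last by rewrite -exprM.
  by rewrite sqrtr_sqr ger0_norm// sqr_ge0.
have t40 : 0 < t k ^+ 4 by rewrite exprn_gt0.
have Wu := walk_mean_ncdf_cvg (z + 1 * t k) _ t40.
have Wl := walk_mean_ncdf_cvg (z + -1 * t k) _ t40.
rewrite st in Wu Wl.
have tN : - (t k)^-1 = (-1 * t k) / t k ^+ 2 by field; rewrite gt_eqF.
have tP : (t k)^-1 = (1 * t k) / t k ^+ 2 by field; rewrite gt_eqF.
set E := 1 - ncdf 1 (t k)^-1 in ku kl.
have E0 : 0 <= E by rewrite subr_ge0 ncdf_le1.
have t20 : 0 < t k ^+ 2 by rewrite exprn_gt0.
have hu x : h x <= ncdf 1 ((z + 1 * t k - x) / t k ^+ 2) + E.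
  have /andP[_] := hz x; move=> /le_trans; apply.
  have [xz|xz] := leP x z; last by rewrite addr_ge0// ncdf_ge0.
  rewrite /E addrCA lerDl subr_ge0 ncdf_le//.
  by rewrite tP ler_pM2r ?invr_gt0//; lra.
have hl x : ncdf 1 ((z + -1 * t k - x) / t k ^+ 2) - E <= h x.
  have /andP[+ _] := hz x; apply: le_trans.
  have [xz|xz] := ltP x z.
    by rewrite lerBlDr (le_trans (ncdf_le1 _ _))// lerDl.
  rewrite subr_le0 /E -ncdfN ?oner_neq0// ncdf_le//.
  by rewrite tN ler_pM2r ?invr_gt0//; lra.
move/cvgrPdist_lt : Wu => /(_ _ e2) Wu; move/cvgrPdist_lt : Wl => /(_ _ e2) Wl.
pose U n c := walk_mean a n
  (fun s => ncdf 1 ((z + c * t k - s / Num.sqrt n.+1%:R) / t k ^+ 2)).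
near=> n.
have nu : `|V 1 k - U n 1| < e / 2.
  by near: n.
have nl : `|V (-1) k - U n (-1)| < e / 2.
  by near: n.
have addE f c : walk_mean a n f + c = walk_mean a n (fun s => f s + c).
  rewrite -[X in _ + X = _](walk_mean_cst a c n) -[X in X + _]mul1r -[X in _ + X]mul1r.
  by rewrite -walk_mean_linear; apply: eq_walk_mean => s; rewrite !mul1r.
have Hu : walk_mean a n (fun s => h (s / Num.sqrt n.+1%:R)) <= U n 1 + E.
  by rewrite /U addE; apply: ler_walk_mean => // s _; exact: hu.
have Hl : U n (-1) - E <= walk_mean a n (fun s => h (s / Num.sqrt n.+1%:R)).
  by rewrite /U addE; apply: ler_walk_mean => // s _; exact: hl.
move: ku kl nu nl Hu Hl; rewrite !ltr_norml.
move: (V _ _) (V _ _) (U _ _) (U _ _) (walk_mean _ _ _) => V1 V2 U1 U2 W.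
move=> /andP[? ?] /andP[? ?] /andP[? ?] /andP[? ?] ? ?; apply/andP; split; lra.
Unshelve. all: by end_near. Qed.

End clt.

(** * Independence *)

Section independence.
Context {d} {T : measurableType d} {R : realType} (P : probability T R).

(** Expectations are later split over finitely many events, each of them independent of the function
    integrated on it. *)
Definition indep_event (C : set T) (g : T -> R) : Prop :=
  forall A, measurable A -> P (C `&` g @^-1` A) = (P C * P (g @^-1` A))%E.

Lemma indep_event_comp (C : set T) (g : T -> R) (f : R -> R) :
  measurable_fun setT f -> indep_event C g -> indep_event C (f \o g).
Proof.
move=> mf Cg A mA; rewrite comp_preimage; apply: Cg.
by rewrite -[_ @^-1` _]setTI; exact: mf.
Qed.

(** Under the restriction of [P] to [C], the image law of [g] is [P C] times its distribution. *)
Lemma ge0_integral_indep (C : set T) (g : T -> R) :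
  measurable C -> measurable_fun setT g -> (forall w, 0 <= g w) ->
  indep_event C g ->
  (\int[P]_(w in C) (g w)%:E = P C * \int[P]_w (g w)%:E)%E.
Proof.
move=> mC mg g0 Cg.
pose G : {mfun T >-> R} := HB.pack g (isMeasurableFun.Build _ _ _ _ g mg).
pose m := mrestr P mC.
have -> : (\int[P]_(w in C) (g w)%:E = \int[m]_(w in C) (g w)%:E)%E.
  apply: eq_measure_integral => A mA AC.
  by rewrite /m /mrestr; congr (P _); apply/esym/setIidPl.
have -> : (\int[m]_(w in C) (g w)%:E = \int[m]_w (g w)%:E)%E.
  have mgE : measurable_fun setT (EFin \o g) by exact/measurable_EFinP.
  rewrite -(setvU C) ge0_integral_setU//; first last.
  - by apply/disj_setPS => w [].
  - by move=> w _; rewrite lee_fin.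
  - by rewrite setvU.
  - exact: measurableC.
  rewrite (@null_set_integral _ _ _ m (~` C)) ?add0e//.
  - exact: measurableC.
  - exact: measurable_funTS.
  - by change (P (~` C `&` C) = 0%E); rewrite setICl measure0.
have Pk : 0 <= fine (P C) by rewrite fine_ge0.
have mnorm : measurable_fun setT (fun x : R => `|x|%:E).
  by apply/measurable_EFinP; exact: normr_measurable.
(* The absolute value agrees with the identity on the values of [g] and is nonnegative on the whole
   line, as the change of variables requires. *)
transitivity (\int[pushforward m G]_x `|x|%:E)%E.
  rewrite ge0_integral_pushforward// preimage_setT.
  by apply: eq_integral => w _ /=; rewrite ger0_norm.
rewrite (@eq_measure_integral _ _ _ _
  (mscale (NngNum Pk) (distribution P G))); last first.
  move=> A mA _; change (P (g @^-1` A `&` C) = (fine (P C))%:E * P (g @^-1` A))%E.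
  by rewrite setIC Cg// fineK// fin_num_measure.
rewrite ge0_integral_mscale// /= fineK ?fin_num_measure//; congr (_ * _)%E.
rewrite ge0_integral_distribution//.
by apply: eq_integral => w _ /=; rewrite ger0_norm.
Qed.

Lemma Rintegral_indep (C : set T) (g : T -> R) :
  measurable C -> P.-integrable setT (EFin \o g) -> indep_event C g ->
  \int[P]_(w in C) g w = fine (P C) * \int[P]_w g w.
Proof.
move=> mC ig Cg.
have mg : measurable_fun setT g by have /integrableP[/measurable_EFinP] := ig.
have inn := integrable_norm ig.
have PC : (P C) \is a fin_num by rewrite fin_num_measure.
have ge0 h : P.-integrable setT (EFin \o h) -> (forall w, 0 <= h w) ->
    indep_event C h -> \int[P]_(w in C) h w = fine (P C) * \int[P]_w h w.
  move=> ih h0 Ch; have /integrableP[/measurable_EFinP mh _] := ih.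
  rewrite /Rintegral ge0_integral_indep// fineM//; exact: integrable_fin_num.
(* Both [|g|] and [|g| - g] are nonnegative functions of [g], hence independent of [C]. *)
have gE w : g w = `|g w| - (`|g w| - g w) by lra.
have iB : P.-integrable setT (EFin \o (fun w => `|g w| - g w)).
  by exact: (@integrableB _ _ _ P _ measurableT _ _ inn ig).
have gED D : \int[P]_(w in D) g w = \int[P]_(w in D) (`|g w| - (`|g w| - g w)).
  by apply: eq_Rintegral => w _; exact: gE.
rewrite gED [in RHS]gED.
rewrite [LHS]RintegralB//; last 2 first.
- exact: integrableS inn.
- exact: integrableS iB.
have -> : \int[P]_(w in C) `|g w| = fine (P C) * \int[P]_w `|g w|.
  apply: (ge0 (fun w => `|g w|)) => //.
  by apply: (indep_event_comp C g Num.norm) => //; exact: normr_measurable.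
have -> : \int[P]_(w in C) (`|g w| - g w) = fine (P C) * \int[P]_w (`|g w| - g w).
  apply: (ge0 (fun w => `|g w| - g w)) => //.
    by move=> w; rewrite subr_ge0 ler_norm.
  apply: (indep_event_comp C g (fun x => `|x| - x)) => //.
  by apply: measurable_funB => //; exact: normr_measurable.
by rewrite -mulrBr -RintegralB.
Qed.

Lemma Rintegral_sum (D : set T) (I : Type) (r : seq I) (F : I -> T -> R) :
  measurable D -> (forall i, P.-integrable D (EFin \o F i)) ->
  \int[P]_(w in D) (\sum_(i <- r) F i w) = \sum_(i <- r) \int[P]_(w in D) F i w.
Proof.
move=> mD iF; elim: r => [|i r IH].
  rewrite big_nil -[RHS](mul0r (fine (P D))) -Rintegral_cst//.
  by apply: eq_Rintegral => w _; rewrite big_nil.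
rewrite big_cons -IH -RintegralD//; last first.
  apply: eq_integrable (@integrable_sum _ _ _ P _ mD _ r xpredT _
    (fun i _ => iF i)) => // w _.
  by rewrite /= sumEFin.
by apply: eq_Rintegral => w _; rewrite big_cons.
Qed.

End independence.

(** * The elephant random walk *)

(** Only the integers from [-(n + 1)] to [n + 1] are ever evaluated; parity is not tracked. *)
Lemma eq_walk_mean_lattice {R : realType} (a : R) n (h g : R -> R) :
  (forall j, (j <= n.+1.*2)%N -> h (j%:R - n.+1%:R) = g (j%:R - n.+1%:R)) ->
  walk_mean a n h = walk_mean a n g.
Proof.
elim: n h g => [|n IH] h g hg /=.
  by have := hg 2 isT; rewrite (_ : 2 - 1 = 1 :> R)//; ring.
apply: IH => j jn; rewrite /walk_step.
have -> : (j%:R - n.+1%:R + 1 : R) = j.+2%:R - n.+2%:R by rewrite -!natr1; ring.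
have -> : (j%:R - n.+1%:R - 1 : R) = j%:R - n.+2%:R by rewrite -!natr1; ring.
by rewrite !hg// doubleS ?ltnS ?(leq_trans jn)// -addn2 leq_addr.
Qed.

Section elephant.
Context {d} {T : measurableType d} {R : realType} {P : probability T R} {p : R}
  {X : nat -> {RV P >-> R}}.
Hypotheses (hX : elephant_random_walk P p X).

Let a := 2 * p - 1.

Lemma walkS n w : walk X n.+1 w = walk X n w + X n.+1 w.
Proof. by rewrite /walk big_nat_recr. Qed.

Lemma elephant_step_sign n w : (1 <= n)%N -> X n w = 1 \/ X n w = -1.
Proof.
elim/ltn_ind: n => -[//|[|n]] IH _; first by left; exact: (erw_first hX).
have [K [B [Kn _ _ _ ->]]] := erw_step hX (ltn0Sn n).
have /andP[K1 K2] := Kn w.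
have := IH (K w) K2 K1.
by case: (B w) => -[->|->]; rewrite ?opprK; [left|right|right|left].
Qed.

Lemma walk_lattice n w :
  exists2 j, (j <= n.*2)%N & walk X n w = j%:R - n%:R.
Proof.
elim: n => [|n [j jn E]].
  by exists 0%N; rewrite // /walk big_geq// subrr.
rewrite walkS E; have [->|->] := elephant_step_sign n.+1 w (ltn0Sn n).
  by exists j.+2; [rewrite doubleS|rewrite -!natr1; ring].
exists j; last by rewrite -!natr1; ring.
by rewrite doubleS (leq_trans jn)// -addn2 leq_addr.
Qed.

Lemma walk_norm_le n w : `|walk X n w| <= n%:R.
Proof.
have [j jn ->] := walk_lattice n w.
have : (j%:R : R) <= n%:R + n%:R by rewrite -natrD ler_nat addnn.
have : (0 : R) <= j%:R by [].
by rewrite ler_norml; lra.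
Qed.

(** The sum over the remembered step [k], with [e] telling whether it is repeated or reversed; it
    depends on the past only through the position, which makes the walk Markovian. *)
Lemma sum_walk_shift (h : R -> R) e n w : e = 1 \/ e = -1 ->
  \sum_(k < n) h (walk X n w + e * X k.+1 w) =
  (n%:R + e * walk X n w) / 2 * h (walk X n w + 1) +
  (n%:R - e * walk X n w) / 2 * h (walk X n w - 1).
Proof.
move=> e1; set s := walk X n w.
(* On the two signs every function is affine: mean value plus sign times half the difference. *)
transitivity (\sum_(k < n)
   ((h (s + 1) + h (s - 1)) / 2 + e * X k.+1 w * ((h (s + 1) - h (s - 1)) / 2))).
  apply: eq_bigr => k _.
  have [->|->] := elephant_step_sign k.+1 w (ltn0Sn k); case: e1 => ->;
  by rewrite ?mulN1r ?mulrN1 ?mul1r ?mulr1 ?opprK; field.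
have sE : s = \sum_(k < n) X k.+1 w by rewrite /s /walk big_add1 big_mkord.
rewrite big_split /= sumr_const card_ord -mulr_natl.
by rewrite -mulr_suml -mulr_sumr -sE; field.
Qed.

Lemma sigma_process_preimage (I : set nat) (f : T -> R) (A : set R) :
  measurable_fun (T := g_sigma_algebraType (\bigcup_(k in I) sigma_rv (X k)))
    setT f ->
  measurable A -> sigma_process I X (f @^-1` A).
Proof. by move=> mf mA; have := mf measurableT A mA; rewrite setTI. Qed.

Lemma sigma_process_X (I : set nat) k : I k ->
  measurable_fun (T := g_sigma_algebraType (\bigcup_(k in I) sigma_rv (X k)))
    setT (X k).
Proof.
move=> Ik _ A mA; apply: sub_sigma_algebra.
by exists k => //; exists A.
Qed.

Lemma sigma_process_walk (I : set nat) n : (forall k, (1 <= k <= n)%N -> I k) ->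
  measurable_fun (T := g_sigma_algebraType (\bigcup_(k in I) sigma_rv (X k)))
    setT (walk X n).
Proof.
elim: n => [|n IH] In.
  rewrite (_ : walk X 0 = cst 0); first exact: measurable_cst.
  by apply/funext => w; rewrite /walk big_geq.
rewrite (_ : walk X n.+1 = walk X n \+ X n.+1); last first.
  by apply/funext => w; rewrite walkS.
apply: measurable_funD.
  by apply: IH => k /andP[k1 kn]; apply: In; rewrite k1 (leq_trans kn).
by apply: sigma_process_X; apply: In; rewrite ltnSn.
Qed.

Lemma measurable_walk n : measurable_fun setT (walk X n).
Proof. by apply: measurable_sum. Qed.

Lemma indep_steps n (K : {RV P >-> nat}) (B : {RV P >-> bool}) k b (g : T -> R) :
  independent3 P (sigma_process [set k | (1 <= k <= n)%N] X)
    (sigma_rv K) (sigma_rv B) ->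
  (forall A, measurable A ->
    sigma_process [set k | (1 <= k <= n)%N] X (g @^-1` A)) ->
  indep_event P ([set w | K w = k] `&` [set w | B w = b]) g /\
  (P ([set w | K w = k] `&` [set w | B w = b]) =
    P [set w | K w = k] * P [set w | B w = b])%E.
Proof.
move=> ind mg.
have Kk : sigma_rv K [set w | K w = k] by exists [set k] => //; rewrite setTI.
have Bb : sigma_rv B [set w | B w = b] by exists [set b] => //; rewrite setTI.
have PKB : (P ([set w | K w = k] `&` [set w | B w = b]) =
    P [set w | K w = k] * P [set w | B w = b])%E.
  have := ind (g @^-1` setT) _ _ (mg _ measurableT) Kk Bb.
  by rewrite preimage_setT setTI probability_setT mul1e.
split=> [A mA|//]; rewrite setIC setIA ind//; last exact: mg.
by rewrite PKB -muleA muleC.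
Qed.

(** Suffices for integrability, the walk being bounded at each time, and is preserved by
    [walk_step]; global boundedness in general is not, as the weights are affine in [s]. *)
Definition locally_bounded (h : R -> R) :=
  forall M, exists C, forall s, `|s| <= M -> `|h s| <= C.

Lemma bounded_integrable (g : T -> R) C : measurable_fun setT g ->
  (forall w, `|g w| <= C) -> P.-integrable setT (EFin \o g).
Proof.
move=> mg gC; apply: measurable_bounded_integrable => //.
  by rewrite (le_lt_trans (probability_le1 _ _))// ltry.
exists C; split; first exact: num_real.
by move=> x Cx w _ /=; apply: le_trans (gC w) _; exact: ltW.
Qed.

Lemma locally_bounded_walk_step b m (h : R -> R) :
  locally_bounded h -> locally_bounded (walk_step b m h).
Proof.
move=> bh M; have [C CP] := bh (M + 1).
exists ((1 + `|b * m^-1| * M) * C) => s sM.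
have M0 : 0 <= M by apply: le_trans sM.
have h1 : `|h (s + 1)| <= C.
  by rewrite CP// (le_trans (ler_normD _ _))// normr1 lerD2r.
have h2 : `|h (s - 1)| <= C.
  by rewrite CP// (le_trans (ler_normB _ _))// normr1 lerD2r.
have C0 : 0 <= C by apply: le_trans h1.
have u : `|b * (s / m)| <= `|b * m^-1| * M.
  by rewrite (_ : b * (s / m) = (b * m^-1) * s); [rewrite normrM ler_wpM2l|ring].
move: (`|b * m^-1| * M) u => q; rewrite /walk_step.
move: (b * (s / m)) => v vq.
have q0 : 0 <= q by apply: le_trans vq.
rewrite (le_trans (ler_normD _ _))// !normrM.
have c1 : `|1 + v| <= 1 + q by rewrite (le_trans (ler_normD _ _))// normr1 lerD2l.
have c2 : `|1 - v| <= 1 + q by rewrite (le_trans (ler_normB _ _))// normr1 lerD2l.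
rewrite normfV (@ger0_norm _ 2)//.
have d1 := ler_pM (normr_ge0 _) (normr_ge0 _) c1 h1.
have d2 := ler_pM (normr_ge0 _) (normr_ge0 _) c2 h2.
lra.
Qed.

Lemma measurable_walk_step b m (h : R -> R) :
  measurable_fun setT h -> measurable_fun setT (walk_step b m h).
Proof.
move=> mh; rewrite /walk_step.
have sh c : measurable_fun setT (fun s : R => h (s + c)).
  by apply: (measurableT_comp mh); exact: measurable_funD.
apply: measurable_funD; apply: measurable_funM => //; apply: measurable_funM => //;
  [apply: measurable_funD => //|apply: measurable_funB => //];
  by apply: measurable_funM => //; exact: measurable_funM.
Qed.

(** The space is split according to the remembered index and the sign choice; each piece is
    independent of the past, so its probability factors out. *)
Lemma expectation_walk n (h : R -> R) : measurable_fun setT h ->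
  locally_bounded h -> \int[P]_w h (walk X n.+1 w) = walk_mean a n h.
Proof.
elim: n h => [|n IH] h mh bh.
  rewrite (@eq_Rintegral _ _ _ P setT (cst (h 1))); last first.
    by move=> w _; rewrite /walk big_nat1 (erw_first hX).
  by rewrite Rintegral_cst//= probability_setT mulr1.
rewrite /= -IH; last 2 first.
- exact: measurable_walk_step.
- exact: locally_bounded_walk_step.
have [K [B [Kn PK PB ind XS]]] := erw_step hX (ltn0Sn n).
pose e (b : bool) : R := if b then 1 else -1.
pose q (b : bool) : R := if b then p else 1 - p.
pose C k b := [set w | K w = k] `&` [set w | B w = b].
have PBq b : P [set w | B w = b] = (q b)%:E.
  case: b; first exact: PB.
  rewrite (_ : [set w | B w = false] = ~` [set w | B w = true]); last first.
    by apply/seteqP; split => w /=; case: (B w).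
  rewrite probability_setC ?PB//.
  exact: (@measurable_funPTI _ _ _ _ B [set true]).
have mC k b : measurable (C k b).
  apply: measurableI.
    exact: (@measurable_funPTI _ _ _ _ K [set k]).
  exact: (@measurable_funPTI _ _ _ _ B [set b]).
have iC k b w : \1_(C k b) w = ((K w == k) && (B w == b))%:R :> R.
  rewrite indicE; congr (nat_of_bool _)%:R; apply/idP/andP.
    by rewrite inE => -[-> ->].
  by move=> [/eqP ? /eqP ?]; rewrite inE.
pose g (b : bool) (k : 'I_n.+1) w := h (walk X n.+1 w + e b * X k.+1 w).
have gF b k A : measurable A ->
    sigma_process [set k | (1 <= k <= n.+1)%N] X (g b k @^-1` A).
  apply: sigma_process_preimage; apply: (measurableT_comp mh).
  apply: measurable_funD; first exact: sigma_process_walk.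
  apply: measurable_funM => //.
  by apply: sigma_process_X; rewrite /= ltn_ord.
have mg b k : measurable_fun setT (g b k).
  apply: (measurableT_comp mh); apply: measurable_funD; first exact: measurable_walk.
  exact: measurable_funM.
have [M MP] := bh (n.+2)%:R.
have ig b k : P.-integrable setT (EFin \o g b k).
  apply: (bounded_integrable _ M) => // w; apply: MP.
  rewrite -natr1 (le_trans (ler_normD _ _))// lerD ?walk_norm_le//.
  have [->|->] := elephant_step_sign k.+1 w (ltn0Sn k);
    by case: (b); rewrite /e ?mulr1 ?mulrN1 ?opprK ?normrN normr1.
(* Exactly one pair of index and sign choice is active at [w]. *)
have hE w : h (walk X n.+2 w) = \sum_(k < n.+1)
   (\1_(C k.+1 true) w * g true k w + \1_(C k.+1 false) w * g false k w).
  have /andP[K1 K2] := Kn w.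
  have Kn1 : ((K w).-1 < n.+1)%N by rewrite prednK.
  rewrite (bigD1 (Ordinal Kn1))//= big1 ?addr0.
    rewrite !iC prednK// eqxx /g /= prednK// walkS XS /e.
    by case: (B w); rewrite /= ?mul1r ?mul0r ?addr0 ?add0r ?mulN1r.
  move=> k kK; rewrite !iC (_ : (K w == k.+1) = false) ?mul0r ?addr0//.
  apply: contraNF kK => /eqP KE; apply/eqP/val_inj; by rewrite /= KE.
have igC b (k : 'I_n.+1) :
    P.-integrable setT (EFin \o (fun w => \1_(C k.+1 b) w * g b k w)).
  apply: (@le_integrable _ _ _ P _ measurableT _ (EFin \o g b k)) => //.
    by apply/measurable_EFinP; apply: measurable_funM => //; exact: measurable_indic.
  move=> w _ /=; rewrite lee_fin normrM ler_piMl// iC.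
  by case: (_ && _); rewrite ?normr1 ?normr0.
have intC b (k : 'I_n.+1) : \int[P]_w (\1_(C k.+1 b) w * g b k w) =
    n.+1%:R^-1 * q b * \int[P]_w g b k w.
  have [Cg PC] := indep_steps _ _ _ k.+1 b (g b k) ind (gF b k).
  rewrite (_ : _ * q b = fine (P (C k.+1 b))); last first.
    by rewrite /C PC PBq PK// ltn_ord.
  rewrite -Rintegral_indep// [RHS]Rintegral_mkcond; apply: eq_Rintegral => w _.
  by rewrite patchE indicE; case: (_ \in _); rewrite ?mul1r ?mul0r.
under eq_Rintegral => w _ do rewrite hE.
rewrite Rintegral_sum//; last first.
  move=> k.
  exact: (@integrableD _ _ _ P _ measurableT _ _ (igC true k) (igC false k)).
have isum b : P.-integrable setT (EFin \o (fun w => \sum_(k < n.+1) g b k w)).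
  apply: eq_integrable (@integrable_sum _ _ _ P _ measurableT _
    (index_enum _) xpredT _ (fun k _ => ig b k)) => // w _.
  by rewrite /= sumEFin.
transitivity (\int[P]_w (n.+1%:R^-1 * q true * \sum_(k < n.+1) g true k w +
    n.+1%:R^-1 * q false * \sum_(k < n.+1) g false k w)).
  rewrite RintegralD//; last 2 first.
  - exact: (@integrableZl _ _ _ P _ measurableT _ _ (isum true)).
  - exact: (@integrableZl _ _ _ P _ measurableT _ _ (isum false)).
  rewrite !RintegralZl// !Rintegral_sum// !mulr_sumr -big_split /=.
  by apply: eq_bigr => k _; rewrite RintegralD// !intC.
(* With [x = s / m], [p (1 + x) / 2 + (1 - p) (1 - x) / 2 = (1 + a x) / 2]. *)
apply: eq_Rintegral => w _; rewrite /g !sum_walk_shift /e /q; [|by right|by left].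
rewrite /walk_step /a; field.
by rewrite nat1r pnatr_eq0.
Qed.

End elephant.

(** A form of Fubini: [walk_mean a n] is a finite linear combination of point evaluations. *)
Lemma walk_mean_Rintegral {d} {T : measurableType d} {R : realType}
  (P : probability T R) (a : R) n (f : T -> R -> R) :
  (forall s, P.-integrable setT (EFin \o f^~ s)) ->
  P.-integrable setT (fun w => (walk_mean a n (f w))%:E) /\
  \int[P]_w walk_mean a n (f w) = walk_mean a n (fun s => \int[P]_w f w s).
Proof.
elim: n f => [|n IH] f fi; first by split => //; exact: fi.
have fZ c s : P.-integrable setT (EFin \o (fun w => c * f w s)).
  exact: (@integrableZl _ _ _ P _ measurableT _ _ (fi s)).
have [|I1 E1] := IH (fun w => walk_step a n.+1%:R (f w)).
  by move=> s; exact: (@integrableD _ _ _ P _ measurableT _ _ (fZ _ _) (fZ _ _)).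
split => //; rewrite /= E1; apply: eq_walk_mean => s.
by rewrite /walk_step RintegralD// !RintegralZl.
Qed.

(** * The walk multiplied by an independent factor *)

Section randomized.
Context {d} {T : measurableType d} {R : realType} {P : probability T R} {p : R}
  {X : nat -> {RV P >-> R}} {Y : {RV P >-> R}}.
Hypotheses (hX : elephant_random_walk P p X)
  (hYX : independent2 P (sigma_rv Y) (sigma_process [set k | (1 <= k)%N] X)).

Let a := 2 * p - 1.

Lemma in_preimage_set1 (f : T -> R) (v : R) w :
  (w \in f @^-1` [set v]) = (f w == v).
Proof. by apply/idP/eqP; rewrite inE. Qed.

Lemma prob_walk n v :
  fine (P (walk X n.+1 @^-1` [set v])) = walk_mean a n (fun s => (s == v)%:R).
Proof.
rewrite -(expectation_walk hX); last 2 first.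
- rewrite (_ : (fun s => _) = \1_[set v]); first exact: measurable_indic.
  apply/funext => s; rewrite indicE; congr (nat_of_bool _)%:R.
  by apply/eqP/idP; rewrite inE.
- by move=> M; exists 1 => s _; case: eqP; rewrite ?normr1 ?normr0.
rewrite -[LHS]mul1r -Rintegral_cst; last first.
  by rewrite -[X in measurable X]setTI; exact: measurable_walk.
rewrite Rintegral_mkcond; apply: eq_Rintegral => w _.
by rewrite patchE in_preimage_set1; case: eqP.
Qed.

(** The walk takes finitely many values, so the expectation is a finite sum over them, and each term
    factors by independence of [Y] and the walk. *)
Lemma randomized_walk_mean n (f : R -> R -> R) :
  (forall s, measurable_fun setT (f^~ s)) ->
  (forall s, P.-integrable setT (EFin \o (fun w => f (Y w) s))) ->
  P.-integrable setT (fun w => (f (Y w) (walk X n.+1 w))%:E) /\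
  \int[P]_w f (Y w) (walk X n.+1 w) =
  walk_mean a n (fun s => \int[P]_w f (Y w) s).
Proof.
move=> mf fi.
pose pt (j : nat) : R := j%:R - n.+1%:R.
pose C j := walk X n.+1 @^-1` [set pt j].
have mC j : measurable (C j).
  by rewrite -[X in measurable X]setTI; exact: measurable_walk.
have iC j w : \1_(C j) w = (walk X n.+1 w == pt j)%:R :> R.
  by rewrite indicE in_preimage_set1.
have pt_inj i j : (pt i == pt j) = (i == j).
  by rewrite /pt (inj_eq (addIr _)) eqr_nat.
have mfY s : measurable_fun setT (fun w => f (Y w) s).
  exact: (measurableT_comp (mf s)).
have fE w : f (Y w) (walk X n.+1 w) =
    \sum_(j < n.+1.*2.+1) \1_(C j) w * f (Y w) (pt j).
  have [j jn E] := walk_lattice hX n.+1 w.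
  have jn1 : (j < n.+1.*2.+1)%N by rewrite ltnS.
  rewrite (bigD1 (Ordinal jn1))//= iC E eqxx mul1r big1 ?addr0//.
  move=> i ij; rewrite iC E pt_inj (_ : (j == i) = false) ?mul0r//.
  by apply: contraNF ij => /eqP ji; apply/eqP/val_inj.
have igC j : P.-integrable setT (EFin \o (fun w => \1_(C j) w * f (Y w) (pt j))).
  apply: (@le_integrable _ _ _ P _ measurableT _ _ _ _ (fi (pt j))).
    by apply/measurable_EFinP; apply: measurable_funM => //; exact: measurable_indic.
  move=> w _ /=; rewrite lee_fin normrM ler_piMl// iC.
  by case: (_ == _); rewrite ?normr1 ?normr0.
have intC j : \int[P]_w (\1_(C j) w * f (Y w) (pt j)) =
    walk_mean a n (fun s => (s == pt j)%:R) * \int[P]_w f (Y w) (pt j).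
  rewrite -prob_walk -Rintegral_indep//; last first.
    move=> A mA; rewrite setIC [RHS]muleC; apply: hYX.
      exists (f^~ (pt j) @^-1` A); last by rewrite setTI.
      by rewrite -[X in measurable X]setTI; exact: mf.
    by apply: sigma_process_preimage => //; apply: sigma_process_walk => k /andP[].
- exact: mC.
  rewrite [RHS]Rintegral_mkcond; apply: eq_Rintegral => w _.
  by rewrite patchE indicE; case: (_ \in _); rewrite ?mul1r ?mul0r.
split.
  apply: eq_integrable (@integrable_sum _ _ _ P _ measurableT _
    (index_enum _) xpredT _ (fun (j : 'I_(n.+1.*2.+1)) _ => igC j)) => // w _.
  by rewrite /= sumEFin fE.
under eq_Rintegral => w _ do rewrite fE.
rewrite Rintegral_sum//.
transitivity (walk_mean a n (fun s =>
  \sum_(j < n.+1.*2.+1) (\int[P]_w f (Y w) (pt j)) * (s == pt j)%:R)).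
  rewrite (walk_mean_sum a n _ _
    (fun (j : 'I_(n.+1.*2.+1)) s => (\int[P]_w f (Y w) (pt j)) * (s == pt j)%:R)).
  apply: eq_bigr => j _; rewrite intC mulrC.
  by rewrite -walk_meanZ.
apply: eq_walk_mean_lattice => j jn.
have jn1 : (j < n.+1.*2.+1)%N by rewrite ltnS.
rewrite (bigD1 (Ordinal jn1))//= eqxx mulr1 big1 ?addr0//.
move=> i ij; rewrite pt_inj (_ : (j == i) = false) ?mulr0//.
by apply: contraNF ij => /eqP ji; apply/eqP/val_inj.
Qed.
End randomized.

(** * The limit law *)

(* The distribution function at [x] of [y] times a centered normal variable of
   standard deviation [s]; a point mass when [y = 0]. *)
Definition scaled_ncdf {R : realType} (s x y : R) : R :=
  if y == 0 then (0 <= x)%R%:R else ncdf s (x / `|y|).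

Lemma scaled_walk_mean_cvg {R : realType} (a x y : R) :
  -1 <= a <= 1 -> a < 1 / 2 ->
  walk_mean a n (fun s => (y * s / Num.sqrt n.+1%:R <= x)%R%:R) @[n --> \oo] -->
  scaled_ncdf (Num.sqrt (1 - 2 * a)^-1) x y.
Proof.
move=> a1 a2; rewrite /scaled_ncdf.
have k0 : Num.sqrt (1 - 2 * a)^-1 != 0.
  by rewrite gt_eqF// sqrtr_gt0 invr_gt0; lra.
have [->|y0] := eqVneq y 0.
  apply: eq_cvg_to (cvg_cst _) => n; rewrite -[LHS](walk_mean_cst a _ n).
  by apply: eq_walk_mean => s; rewrite !mul0r.
case: (ltgtP y 0) y0 => // y0 _.
  rewrite ltr0_norm// invrN mulrN ncdfN//.
  (* Dividing by a negative [y] reverses the inequality, so the event is the complement of a strict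
     one. *)
  pose h u : R := (u < x / y)%R%:R.
  have hh u : (u < x / y)%R%:R <= h u <= (u <= x / y)%R%:R.
    by rewrite lexx ler_nat; case: ltgtP.
  have H := walk_mean_cdf_cvg a a1 a2 (x / y) h hh.
  have H' : 1 - walk_mean a n (fun s => h (s / Num.sqrt n.+1%:R)) @[n --> \oo] -->
      1 - ncdf (Num.sqrt (1 - 2 * a)^-1) (x / y).
    by apply: cvgB => //; exact: cvg_cst.
  apply: eq_cvg_to H' => n.
  rewrite -[X in X - _](walk_mean_cst a 1 n) -[X in X - _]mul1r -mulN1r.
  rewrite -walk_mean_linear; apply: eq_walk_mean => s.
  have -> : (y * s / Num.sqrt n.+1%:R <= x) = (x / y <= s / Num.sqrt n.+1%:R).
    by rewrite [RHS]ler_ndivrMr// [_ * y]mulrC mulrA.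
  by rewrite mul1r mulN1r /h leNgt; case: (_ < _); rewrite ?subrr ?subr0.
rewrite gtr0_norm//.
pose h u : R := (u <= x / y)%R%:R.
have hh u : (u < x / y)%R%:R <= h u <= (u <= x / y)%R%:R.
  by rewrite lexx ler_nat /h; case: ltgtP.
apply: eq_cvg_to (walk_mean_cdf_cvg a a1 a2 (x / y) h hh) => n.
apply: eq_walk_mean => s.
by rewrite /h ler_pdivlMr// mulrAC (mulrC s).
Qed.

Lemma normal_prob_itv_open {R : realType} (s c : R) :
  normal_prob 0 s `]-oo, c[%classic = (ncdf s c)%:E.
Proof.
rewrite -ncdfE /normal_prob; apply: integral_itv_bndo_bndc.
apply/measurable_EFinP; apply: measurable_funTS; exact: measurable_normal_pdf.
Qed.

(** Identifies [scaled_ncdf] as the probability of a section of a measurable set in the plane, from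
    which its measurability follows. *)
Lemma normal_prob_scaled {R : realType} (s x y : R) : s != 0 ->
  normal_prob 0 s [set z | y * z <= x] = (scaled_ncdf s x y)%:E.
Proof.
move=> s0; rewrite /scaled_ncdf.
have [->|y0] := eqVneq y 0.
  case: (leP 0 x) => x0.
    rewrite (_ : [set _ | _] = setT) ?probability_setT//.
    by apply/seteqP; split => z //= _; rewrite mul0r.
  rewrite (_ : [set _ | _] = set0) ?measure0//.
  by apply/seteqP; split => z //=; rewrite mul0r leNgt x0.
case: (ltgtP y 0) y0 => // y0 _.
  rewrite ltr0_norm// invrN mulrN ncdfN//.
  rewrite (_ : [set _ | _] = ~` `]-oo, (x / y)[%classic); last first.
    apply/seteqP; split => z /=; rewrite in_itv/= [y * z]mulrC -ler_ndivrMr//.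
      by rewrite leNgt => /negP.
    by move=> /negP; rewrite -leNgt.
  by rewrite probability_setC// EFinB; congr (1 - _)%E; exact: normal_prob_itv_open.
rewrite gtr0_norm// -ncdfE; congr normal_prob.
by apply/seteqP; split => z /=; rewrite in_itv/= ler_pdivlMr// mulrC.
Qed.

Section limit_law.
Context {d} {T : measurableType d} {R : realType} {P : probability T R}
  (Y : {RV P >-> R}) {s : R}.
Hypothesis s0 : s != 0.

Lemma measurable_le_mul (x : R) :
  measurable [set yz : measurableTypeR R * measurableTypeR R | yz.1 * yz.2 <= x].
Proof.
have mM : measurable_fun setT
    (fun yz : measurableTypeR R * measurableTypeR R => yz.1 * yz.2).
  by apply: measurable_funM; [exact: measurable_fst|exact: measurable_snd].
rewrite (_ : mkset _ = (fun yz => yz.1 * yz.2) @^-1` `]-oo, x]); last first.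
  by apply/seteqP; split => -[y z] /=; rewrite in_itv.
by rewrite -[X in measurable X]setTI; exact: mM.
Qed.

Lemma measurable_scaled_ncdf x : measurable_fun setT (scaled_ncdf s x).
Proof.
apply/measurable_EFinP.
have := measurable_fun_xsection (normal_prob 0 s) (measurable_le_mul x).
apply: eq_measurable_fun => y _ /=; rewrite -normal_prob_scaled//; congr normal_prob.
by apply/seteqP; split => z; rewrite /xsection /= inE.
Qed.

Lemma scaled_ncdf_ge0 x y : 0 <= scaled_ncdf s x y.
Proof. by rewrite /scaled_ncdf; case: ifP => // _; exact: ncdf_ge0. Qed.

(** The measure is the law of the product of coordinates under the product of the distribution of
    [Y] and the normal law. *)
Lemma scaled_normal_law : exists mu : probability (measurableTypeR R) R,
  forall x, mu `]-oo, x]%classic = (\int[P]_w (scaled_ncdf s x (Y w))%:E)%E.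
Proof.
pose M (yz : R * measurableTypeR R) : measurableTypeR R := yz.1 * yz.2.
have mM : measurable_fun setT M.
  by apply: measurable_funM; [exact: measurable_fst|exact: measurable_snd].
pose MF : {mfun _ >-> measurableTypeR R} :=
  HB.pack M (isMeasurableFun.Build _ _ _ _ M mM).
pose Q := (distribution P Y \x normal_prob 0 s)%E.
exists (distribution Q MF) => x.
have mH : measurable_fun setT (EFin \o scaled_ncdf s x).
  by apply/measurable_EFinP; exact: measurable_scaled_ncdf.
have H0 y : (0 <= (EFin \o scaled_ncdf s x) y)%E.
  by rewrite lee_fin scaled_ncdf_ge0.
rewrite -[RHS](ge0_integral_distribution Y mH H0).
apply: eq_integral => y _ /=; rewrite -normal_prob_scaled//; congr normal_prob.
by apply/seteqP; split => z; rewrite /xsection /= inE /= in_itv.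
Qed.

(** The integral over the values of [Y] is split at the origin, where the integrand is the indicator
    of [0 <= x]. *)
Lemma limit_cdf_scaled p x : s = Num.sqrt (3 - 4 * p)^-1 ->
  limit_cdf P p Y x = (\int[P]_w (scaled_ncdf s x (Y w))%:E)%E.
Proof.
move=> sE; rewrite /limit_cdf.
have mH : measurable_fun setT (EFin \o scaled_ncdf s x).
  by apply/measurable_EFinP; exact: measurable_scaled_ncdf.
have H0 y : (0 <= (EFin \o scaled_ncdf s x) y)%E.
  by rewrite lee_fin scaled_ncdf_ge0.
rewrite -[RHS](ge0_integral_distribution Y mH H0).
have m0 : measurable [set 0 : R] by exact: measurable_set1.
rewrite -(setvU [set 0 : R]) ge0_integral_setU//; first last.
- by apply/disj_setPS => y [].
- by rewrite setvU.
- exact: measurableC.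
congr (_ + _)%E.
  rewrite (_ : [set t : R | t != 0] = ~` [set 0]); last first.
    by apply/seteqP; split => t /eqP.
  apply: eq_integral => t; rewrite inE => /eqP t0.
  by rewrite /normal_cdf -sE ncdfE /= /scaled_ncdf (negbTE t0).
rewrite (@eq_integral _ _ _ _ _ (cst (0 <= x)%R%:R%:E)); last first.
  by move=> y; rewrite inE => -> /=; rewrite /scaled_ncdf eqxx.
rewrite integral_cst// muleC indicE; congr (_%:R%:E * _)%E.
by rewrite mem_setE in_itv/= andbT.
Qed.

End limit_law.

(** * Convergence of the distribution functions and of the moments *)

Section limits.
Context {d} {T : measurableType d} {R : realType} {P : probability T R} {p : R}
  {X : nat -> {RV P >-> R}} {Y : {RV P >-> R}}.
Hypotheses (p0 : 0 < p) (p34 : p < 3 / 4) (hX : elephant_random_walk P p X)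
  (hYX : independent2 P (sigma_rv Y) (sigma_process [set k | (1 <= k)%N] X)).

Let a := 2 * p - 1.

Let a1 : -1 <= a <= 1.
Proof. by rewrite /a; apply/andP; split; move: p0 p34; lra. Qed.

Let a2 : a < 1 / 2.
Proof. by rewrite /a; move: p34; lra. Qed.

Let kE : (1 - 2 * a)^-1 = (3 - 4 * p)^-1.
Proof. by congr (_^-1); rewrite /a; ring. Qed.

Lemma cdf_scaled_walk_cvg x :
  cdf (scaled_walk Y X n : {RV P >-> R}) x @[n --> \oo] -->
  (\int[P]_w (scaled_ncdf (Num.sqrt (3 - 4 * p)^-1) x (Y w))%:E)%E.
Proof.
rewrite -(cvg_shiftS (fun n => cdf (scaled_walk Y X n : {RV P >-> R}) x)).
pose f n (y s : R) : R := (y * s / Num.sqrt n.+1%:R <= x)%R%:R.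
have fm n s : measurable_fun setT (f n ^~ s).
  rewrite (_ : f n ^~ s = \1_((fun y => y * s / Num.sqrt n.+1%:R) @^-1` `]-oo, x])).
    apply: measurable_indic; rewrite -[X in measurable X]setTI.
    by apply: measurable_funM => //; apply: measurable_funM.
  apply/funext => y; rewrite indicE /f; congr (nat_of_bool _)%:R.
  by apply/idP/idP; rewrite inE /= in_itv.
have f01 n y s : `|f n y s| <= 1.
  by rewrite /f; case: (_ <= x); rewrite ?normr1 ?normr0.
have fi n s : P.-integrable setT (EFin \o (fun w => f n (Y w) s)).
  by apply: (bounded_integrable _ 1) => //; apply: (measurableT_comp (fm n s)).
(* The order of averaging is exchanged, so that [Y] is frozen inside [walk_mean] and dominated
   convergence applies in [w] with bound [1]. *)
have E n : cdf (scaled_walk Y X n.+1 : {RV P >-> R}) x =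
    (\int[P]_w (walk_mean a n (f n (Y w)))%:E)%E.
  have [J1 J2] := randomized_walk_mean hX hYX n (f n) (fm n) (fi n).
  have [W1 W2] := walk_mean_Rintegral P a n (fun w => f n (Y w)) (fi n).
  rewrite -[RHS]fineK ?integrable_fin_num// -/(Rintegral _ _ _) W2 -J2.
  rewrite /Rintegral fineK ?integrable_fin_num//.
  transitivity (\int[P]_w (\1_(scaled_walk Y X n.+1 @^-1` `]-oo, x]) w)%:E)%E.
    rewrite integral_indic ?setIT//.
    by rewrite -[X in measurable X]setTI; exact: measurable_scaled_walk.
  apply: eq_integral => w _; rewrite indicE /f; congr (nat_of_bool _)%:R%:E.
  by apply/idP/idP; rewrite inE /= in_itv.
apply: (eq_cvg_to _ (fun n => \int[P]_w (walk_mean a n (f n (Y w)))%:E)%E).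
  by move=> n; rewrite -E.
apply: (@dominated_cvg _ _ _ P _ measurableT _ _ (cst 1%E)) => //.
- move=> n.
  by have [/integrableP[]] :=
    walk_mean_Rintegral P a n (fun w => f n (Y w)) (fi n).
- move=> w _; apply: cvg_EFin; first by near=> n.
  by rewrite -kE; exact: scaled_walk_mean_cvg.
- by apply: (bounded_integrable (cst 1) 1) => // w; rewrite normr1.
- move=> n w _ /=; rewrite lee_fin.
  have := walk_mean_dist a n (f n (Y w)) (cst 0) (cst 1) a1.
  rewrite !walk_mean_cst subr0; apply => s _.
  by rewrite subr0.
Unshelve. all: by end_near. Qed.

Hypothesis Y2 : ('E_P[fun w => (Y w ^+ 2)%R] < +oo)%E.

Let mY : measurable_fun setT Y.
Proof. by []. Qed.

Let mY2 : measurable_fun setT (fun w => Y w ^+ 2).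
Proof. exact: measurable_funX. Qed.

Let iY2 : P.-integrable setT (EFin \o (fun w => Y w ^+ 2)).
Proof.
apply/integrableP; split; first exact/measurable_EFinP.
apply: le_lt_trans Y2; rewrite unlock le_eqVlt; apply/orP; left; apply/eqP.
by apply: eq_integral => w _ /=; rewrite ger0_norm ?sqr_ge0.
Qed.

Let iY : P.-integrable setT (EFin \o Y).
Proof.
(* Integrability of [Y] follows from [|Y| <= 1 + Y^2]. *)
have i1 : P.-integrable setT (EFin \o (fun w => 1 + Y w ^+ 2)).
  apply: (@integrableD _ _ _ P _ measurableT (EFin \o cst 1) _ _ iY2).
  by apply: (bounded_integrable (cst 1) 1) => // w; rewrite normr1.
apply: (@le_integrable _ _ _ P _ measurableT _ _ _ _ i1).
  exact/measurable_EFinP.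
move=> w _ /=; rewrite lee_fin [leRHS]ger0_norm ?addr_ge0 ?sqr_ge0//.
rewrite ler_norml; have := sqr_ge0 (Y w - 1); have := sqr_ge0 (Y w + 1).
by move=> h1 h2; apply/andP; split; nra.
Qed.

(** Independence factors the mean into that of [Y] and that of the walk, which is [o (sqrt n)]. *)
Lemma mean_scaled_walk_cvg0 : 'E_P[scaled_walk Y X n]%E @[n --> \oo] --> 0%E.
Proof.
rewrite -(cvg_shiftS (fun n => 'E_P[scaled_walk Y X n]%E)).
have E n : 'E_P[scaled_walk Y X n.+1]%E =
   ((\int[P]_w Y w) * (walk_mean a n id / Num.sqrt n.+1%:R))%:E.
  pose c : R := (Num.sqrt n.+1%:R)^-1.
  have [s|s|J1 J2] := randomized_walk_mean hX hYX n (fun y s => y * s * c).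
  - by apply: measurable_funM => //; apply: measurable_funM.
  - apply: eq_integrable (@integrableZl _ _ _ P _ measurableT
      (s * c) _ iY) => // w _.
    by rewrite /= -EFinM mulrC mulrA.
  rewrite unlock -[LHS]fineK ?integrable_fin_num//; congr EFin.
  rewrite [LHS]J2.
  rewrite (_ : _ * (_ / _) = (\int[P]_w Y w) * c * walk_mean a n id); last first.
    by rewrite /c; ring.
  rewrite -walk_meanZ; apply: eq_walk_mean => s.
  rewrite -mulrA mulrC -RintegralZl//; apply: eq_Rintegral => w _; ring.
rewrite (funext E).
apply: cvg_EFin; first by near=> n.
rewrite -(mulr0 (\int[P]_w Y w)); apply: cvgM; first exact: cvg_cst.
exact: walk_mean_id_cvg0.
Unshelve. all: by end_near. Qed.

Lemma msq_scaled_walk_cvg :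
  'E_P[fun w => (scaled_walk Y X n w ^+ 2)%R]%E @[n --> \oo] -->
    ('E_P[fun w => (Y w ^+ 2)%R] * ((3 - 4 * p)^-1)%:E)%E.
Proof.
rewrite -(cvg_shiftS (fun n => 'E_P[fun w => (scaled_walk Y X n w ^+ 2)%R]%E)).
have E n : 'E_P[fun w => (scaled_walk Y X n.+1 w ^+ 2)%R]%E =
   ((\int[P]_w (Y w ^+ 2)) * (walk_msq a n / n.+1%:R))%:E.
  pose c : R := (Num.sqrt n.+1%:R)^-1.
  have c2 : c ^+ 2 = n.+1%:R^-1 by rewrite /c exprVn sqr_sqrtr.
  have [s|s|J1 J2] := randomized_walk_mean hX hYX n (fun y s => (y * s * c) ^+ 2).
  - by apply: measurable_funX; apply: measurable_funM => //; apply: measurable_funM.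
  - apply: eq_integrable (@integrableZl _ _ _ P _ measurableT
      ((s * c) ^+ 2) _ iY2) => // w _.
    by rewrite /= -EFinM; congr EFin; ring.
  rewrite unlock -[LHS]fineK ?integrable_fin_num//; congr EFin.
  rewrite [LHS]J2 -c2 (_ : _ * (_ * _) =
      (\int[P]_w (Y w ^+ 2)) * c ^+ 2 * walk_msq a n); last first.
    by ring.
  rewrite -walk_meanZ; apply: eq_walk_mean => s.
  rewrite -mulrA mulrC -RintegralZl//; apply: eq_Rintegral => w _; ring.
rewrite (funext E).
have -> : 'E_P[fun w => (Y w ^+ 2)%R]%E = (\int[P]_w (Y w ^+ 2))%:E.
  by rewrite unlock /Rintegral fineK// integrable_fin_num.
rewrite -EFinM; apply: cvg_EFin; first by near=> n.
by apply: cvgM; [exact: cvg_cst|rewrite -kE; exact: walk_msq_cvg].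
Unshelve. all: by end_near. Qed.

End limits.

Theorem theorem4p2 (d : measure_display) (T : measurableType d) (R : realType)
    (P : probability T R) (p : R) (X : nat -> {RV P >-> R}) (Y : {RV P >-> R})
    (hp0 : 0 < p) (hp : p < 3 / 4)
    (hX : elephant_random_walk P p X)
    (hYX : independent2 P (sigma_rv Y) (sigma_process [set k | (1 <= k)%N] X)) :
  (exists mu : probability (measurableTypeR R) R,
     (forall x : R, mu `]-oo, x]%classic = limit_cdf P p Y x) /\
     cvg_in_distribution P (fun n => scaled_walk Y X n) mu) /\
  (('E_P[fun w => (Y w ^+ 2)%R] < +oo)%E ->
     'E_P[scaled_walk Y X n]%E @[n --> \oo] --> 0%E /\
     'E_P[fun w => (scaled_walk Y X n w ^+ 2)%R]%E @[n --> \oo] -->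
       ('E_P[fun w => (Y w ^+ 2)%R] * ((3 - 4 * p)^-1)%:E)%E).
Proof.
split.
  have k0 : Num.sqrt (3 - 4 * p)^-1 != 0.
    by rewrite gt_eqF// sqrtr_gt0 invr_gt0; lra.
  have [mu muE] := scaled_normal_law Y k0.
  exists mu; split=> [x|F x _]; first by rewrite muE (limit_cdf_scaled Y k0 p).
  by rewrite /F muE; exact: cdf_scaled_walk_cvg.
move=> Y2; split; first exact: (mean_scaled_walk_cvg0 hp0 hp hX).
exact: msq_scaled_walk_cvg.
Qed.
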